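(* Let $p$ be a prime. (1) $\rho_p(2,3)=\frac{13831}{19773}$ if $p=3$; $\rho_p(2,3)=1-2p^{-1}\frac{1-p^{-1}}{1-p^{-3}}$ if $p\equiv 1\pmod 3$; $\rho_p(2,3)=1-6p^{-3}\left(\frac{1-p^{-1}}{1-p^{-3}}\right)^3$ if $p\equiv 2\pmod 3$. (2) $\rho_p(3,3)=\frac{6391}{6591}$ if $p=3$; $\rho_p(3,3)=1-\frac{8}{3}p^{-2}(1+p^{-1})^2\left(\frac{1-p^{-1}}{1-p^{-3}}\right)^3$ if $p\equiv1\pmod 3$; $\rho_p(3,3)=1$ if $p\equiv 2\pmod 3$. (3) $\rho_p(4,3)=1-\frac{40}{3}p^{-4}\left(\frac{1-p^{-1}}{1-p^{-3}}\right)^4$ if $p\equiv 1\pmod 3$, and $\rho_p(4,3)=1$ otherwise. (4) $\rho_p(5,3)=1-\frac{80}{3}p^{-6}\left(\frac{1-p^{-1}}{1-p^{-3}}\right)^6$ if $p\equiv 1\pmod 3$, and $\rho_p(5,3)=1$ otherwise. (5) If $n\ge 6$, then $\rho_p(n,3)=1$.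
   Context: For $n,k\in\mathbb{Z}_{\ge 2}$ and $\mathbf a=(a_0,\dots,a_n)$, let $X^k_{\mathbf a}\subset\mathbb{P}^n$ denote the diagonal hypersurface $\sum_{i=0}^n a_ix_i^k=0$. For a prime $p$ let $\mu_p$ be the Haar measure on $\mathbb{Z}_p$ normalized by $\mu_p(\mathbb{Z}_p)=1$, and also the product measure on $\mathbb{Z}_p^{n+1}$. Define $\rho_p(n,k)=\mu_p(\{\mathbf a\in\mathbb{Z}_p^{n+1}: X^k_{\mathbf a}(\mathbb{Q}_p)\neq\emptyset\})$. *)

(* Defs.v *)
From HB Require Import structures.
From mathcomp Require Import all_boot all_order all_algebra.
From mathcomp Require Import all_classical all_reals all_analysis.
Set Implicit Arguments. Unset Strict Implicit. Unset Printing Implicit Defensive.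
Import Order.TTheory GRing.Theory Num.Theory.
Local Open Scope classical_set_scope.
Local Open Scope ring_scope.

(* The p-adic integers Z_p = inverse limit of Z/p^m Z, represented by
   coherent sequences of residues: zdig x m is x mod p^m, in [0, p^m). *)
Record Zp (p : nat) := MkZp {
  zdig : nat -> nat;
  zdig_lt : forall m, (zdig m < p ^ m)%N;
  zdig_coh : forall m, zdig m.+1 = zdig m %[mod p ^ m] }.

(* A point of X^k_a over Q_p: a nonzero x in Q_p^(n+1) with
   sum a_i x_i^k = 0; after clearing denominators, equivalently a nonzero
   x in Z_p^(n+1).  The identity sum a_i x_i^k = 0 in Z_p = lim Z/p^m
   means it holds modulo p^m for every m (ring operations of the
   inverse limit are componentwise). *)
Definition diag_has_point (p n k : nat) (a : 'I_n.+1 -> Zp p) : Prop :=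
  exists x : 'I_n.+1 -> Zp p,
    (exists (i : 'I_n.+1) (m : nat), zdig (x i) m != 0%N) /\
    forall m : nat,
      ((\sum_(i < n.+1) zdig (a i) m * zdig (x i) m ^ k) %% p ^ m)%N = 0%N.

(* Basic ball in Z_p^(n+1): all a with a_i = r_i mod p^m; volume p^-(m(n+1)). *)
Definition zball (p n : nat) (c : nat * ('I_n.+1 -> nat)) : set ('I_n.+1 -> Zp p) :=
  [set a | forall i, zdig (a i) c.1 = c.2 i].

(* Normalized Haar (outer) measure on Z_p^(n+1): infimum of total volume
   of countable covers by balls (Caratheodory construction). *)
Definition haar (R : realType) (p n : nat) (S : set ('I_n.+1 -> Zp p)) : \bar R :=
  ereal_inf [set v : \bar R | exists c : nat -> nat * ('I_n.+1 -> nat),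
     S `<=` \bigcup_j @zball p n (c j) /\
     v = (\sum_(0 <= j <oo) (((p%:R : R) ^- ((c j).1 * n.+1))%:E))%E].

Definition rho (R : realType) (p n k : nat) : \bar R :=
  haar R [set a | @diag_has_point p n k a].

(* Main.v *)
From HB Require Import structures.
From mathcomp Require Import all_boot all_order all_algebra.
From mathcomp Require Import all_classical all_reals all_analysis.
From mathcomp Require Import cyclic finfield ring lra zify.
Require Import Defs.
Import Order.TTheory GRing.Theory Num.Theory.
Set Implicit Arguments. Unset Strict Implicit. Unset Printing Implicit Defensive.
Local Open Scope ring_scope.

(** Solubility of sum a_i x_i^3 = 0 over Q_p only depends on the type of each
    nonzero coefficient a_i = p^v u, that is, on v modulo 3 and on the class of
    the unit u modulo cubes, which is visible modulo p (modulo 9 if p = 3).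
    Indeed the terms of smallest valuation j modulo 3 must cancel modulo p (9),
    and by Hensel's lemma this is sufficient.  A tuple of types is insoluble
    ("bad") iff its types are distinct and the residues v mod 3 satisfy:
    - no condition, with a single unit class, if p = 2 mod 3;
    - each residue occurs at most twice if p = 1 mod 3 (three classes; a ternary
      diagonal cubic form over F_p has a zero, by counting cyclotomic numbers);
    - a residue j occurs at most once, unless j + 1 does not occur, if p = 3.
    A type with v = j mod 3 has measure p^-j (1 - 1/p) / (1 - p^-3) divided by
    the number of classes, and the density is one minus the total weight of the
    bad tuples, a finite sum. *)

(** * p-adic limits and compactness *)

(** The density is only an outer measure, and neither measurability nor additivity is established
    for it. All that is used is that a finite list of balls bounds the density of what it covers,
    and that the whole space has outer measure at least 1. Hence both inequalities come from covers:
    one of the soluble tuples, and one of the insoluble tuples, which is joined to an arbitrary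
    cover of the soluble ones. At level 3K + c most residue tuples reveal all their types and so
    decide solubility; the remaining ones are put into both covers, and their share tends to 0 with
    K. The closed formulas come from a count small enough to evaluate: since the weight of a tuple
    of types depends only on the sum of its residues modulo 3, it suffices to enumerate words over
    these three residues, each carrying its number of admissible choices of classes. *)

Lemma dvdn_sum_congr (I : finType) (d : nat) (F G : I -> nat) :
  (forall i, F i = G i %[mod d])%N ->
  (d %| \sum_i F i)%N = (d %| \sum_i G i)%N.
Proof.
by move=> FG; rewrite /dvdn -modn_summ -[in RHS]modn_summ; under eq_bigr do rewrite FG.
Qed.

Section PadicSequences.
Local Open Scope nat_scope.
Variable p : nat.
Hypothesis p_pr : prime p.
Let p_gt0 : 0 < p := prime_gt0 p_pr.

Lemma zdig_mod (a : Zp p) m M : m <= M -> zdig a M %% p ^ m = zdig a m.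
Proof.
elim: M => [|M IH]; first by rewrite leqn0 => /eqP->; rewrite modn_small ?zdig_lt.
rewrite leq_eqVlt => /orP[/eqP->|]; first by rewrite modn_small ?zdig_lt.
rewrite ltnS => mM; rewrite -(IH mM) -(modn_dvdm (zdig a M.+1) (dvdn_exp2l p mM)).
by rewrite zdig_coh modn_dvdm // dvdn_exp2l.
Qed.

(** Dependent choice of digits. Compactness of Z_p^d enters only here: [P m x] will say that the
    level-m ball around x contains approximate solutions of every precision, or that it is covered
    by less than its own volume. *)
Lemma Zp_limit d (P : nat -> ('I_d -> nat) -> Prop) :
  P 0 (fun=> 0) ->
  (forall m x, (forall i, x i < p ^ m) -> P m x ->
    exists k : {ffun 'I_d -> 'I_p}, P m.+1 (fun i => x i + p ^ m * k i)) ->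
  exists a : 'I_d -> Zp p, forall m, P m (fun i => zdig (a i) m).
Proof.
move=> P0 PS.
pose good m x := (forall i : 'I_d, x i < p ^ m) /\ P m x.
(* The premise stays under the [exists] so that choice yields a total function. *)
have step (mx : nat * ('I_d -> nat)) : exists x', good mx.1 mx.2 ->
    good mx.1.+1 x' /\ forall i, x' i = mx.2 i %[mod p ^ mx.1].
  case: mx => m x /=; case: (pselect (good m x)) => [[ltx Px]|ng]; last by exists x.
  have [k Pk] := PS _ _ ltx Px; exists (fun i => x i + p ^ m * k i) => _.
  split; last by move=> i; rewrite addnC mulnC modnMDl.
  split=> // i; rewrite expnS; have := ltn_ord (k i); have := ltx i; nia.
have [g gP] := boolp.choice step.
pose fix X m := if m is m'.+1 then g (m', X m') else fun=> 0.
have gX m : good m (X m).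
  elim: m => [|m IH]; first by split=> // i; rewrite expn0.
  by case: (gP (m, X m) IH).
have cX i m : X m.+1 i = X m i %[mod p ^ m] by case: (gP (m, X m) (gX m)) => _; apply.
have lX i m : X m i < p ^ m by case: (gX m) => + _; apply.
by exists (fun i => MkZp (lX i) (cX i)) => m; case: (gX m).
Qed.

(* König's lemma: keep a residue only if it lifts to solutions of every level. *)
Lemma diag_has_point_compact n k (a : 'I_n.+1 -> Zp p) e :
  (forall M, exists x : 'I_n.+1 -> nat,
     (p ^ M %| \sum_i zdig (a i) M * x i ^ k) /\ exists i, ~~ (p ^ e %| x i)) ->
  diag_has_point k a.
Proof.
move=> solM.
pose sol M (x : 'I_n.+1 -> nat) :=
  (p ^ M %| \sum_i zdig (a i) M * x i ^ k) /\ exists i, ~~ (p ^ e %| x i).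
have sol_dec m M x : m <= M -> sol M x -> sol m x.
  move=> mM [dvdM nz]; split=> //; move: (dvdn_trans (dvdn_exp2l p mM) dvdM).
  rewrite (@dvdn_sum_congr _ _ _ (fun i => zdig (a i) m * x i ^ k)) // => i.
  by rewrite -modnMml zdig_mod.
pose ext m (x : 'I_n.+1 -> nat) := forall M, m <= M ->
  exists X, sol M X /\ forall i, X i %% p ^ m = x i.
have [||x xP] := @Zp_limit n.+1 ext.
- by move=> M _; have [X sX] := solM M; exists X; split=> // i; rewrite modn1.
- move=> m x ltx extx; apply: contrapT => nok.
  (* If every one of the finitely many digit vectors f failed at some level [Mk f], a solution at
     the largest of these levels would have no possible next digits. *)
  have /boolp.choice[Mk MkP] (f : {ffun 'I_n.+1 -> 'I_p}) : exists M, m < M /\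
      forall X, sol M X -> exists i, X i %% p ^ m.+1 <> x i + p ^ m * f i.
    apply: contrapT => nM; apply: nok; exists f => M mM; apply: contrapT => nX.
    apply: nM; exists M; split=> // X sX; apply: contrapT => nX'.
    apply: nX; exists X; split=> // i; apply: contrapT => ni.
    by apply: nX'; exists i.
  have [|X [sX Xm]] := extx (maxn m (\max_f Mk f)); first exact: leq_maxl.
  have ltk i : X i %% p ^ m.+1 %/ p ^ m < p.
    by rewrite ltn_divLR ?expn_gt0 ?p_gt0 // -expnS ltn_mod expn_gt0 p_gt0.
  pose f := [ffun i => Ordinal (ltk i)].
  have [_ /(_ X)] := MkP f.
  case; first by apply: sol_dec sX; rewrite leq_max leq_bigmax orbT.
  move=> i; apply; rewrite ffunE /= [LHS](divn_eq _ (p ^ m)) addnC mulnC.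
  by rewrite modn_dvdm ?Xm // dvdn_exp2l.
exists x; split.
  have [X [[_ [i ni]] Xe]] := xP e e (leqnn _).
  by exists i, e; rewrite -Xe.
move=> m; have [X [[dm _] Xm]] := xP m m (leqnn _).
rewrite -modn_summ; under eq_bigr do rewrite -Xm -modnMmr modnXm modnMmr.
by rewrite modn_summ; apply/eqP.
Qed.

End PadicSequences.

(** * Lifting cube roots *)

Section CubeLifting.
Variable p : nat.
Hypothesis p_pr : prime p.
Let p_gt0 : (0 < p)%N := prime_gt0 p_pr.

(* A p-adic unit is a cube as soon as it is a cube modulo p ^ cube_prec. *)
Definition cube_prec : nat := if p == 3%N then 2%N else 1%N.

Lemma linear_congruence u r : ~~ (p %| u)%N -> exists k, (u * k = r %[mod p])%N.
Proof.
move=> pu; have cpu : coprime p u by rewrite prime_coprime.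
have u_gt0 : (0 < u)%N by case: u pu {cpu}; rewrite ?dvdn0.
exists (chinese p u r 0 %/ u)%N; rewrite mulnC divnK; first by rewrite chinese_modl.
by rewrite /dvdn chinese_modr // mod0n.
Qed.

Lemma linear_congruence_int u (A : int) :
  ~~ (p %| u)%N -> exists k : nat, (p%:Z %| A + u%:Z * k%:Z)%Z.
Proof.
move=> pu; have p0 : p%:Z != 0 by rewrite eqz_nat -lt0n.
have [k kP] := linear_congruence (absz (modz (- A) p)) pu.
exists k; rewrite -[A]opprK addrC -eqz_mod_dvd.
apply/eqP; rewrite -PoszM -[RHS]modz_mod -[X in _ = (X %% _)%Z]gez0_abs ?modz_ge0 //.
by rewrite !modz_nat kP.
Qed.

Lemma dvdz_pX c e : (p%:Z ^+ c %| e%:Z)%Z = (p ^ c %| e)%N.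
Proof. by rewrite dvdzE abszX. Qed.

Lemma PoszX (y c : nat) : (y ^ c)%N%:Z = y%:Z ^+ c.
Proof. by rewrite -natz natrX natz. Qed.

(** Newton's step y + p^(m+1) k. The linear term is 3 y^2 p^(m+1) k, and 3 p^(m+1) is a unit [b]
    times p^(m + cube_prec), with b = 1 if p = 3 and b = 3 otherwise; so k solves a linear
    congruence modulo p in both cases. *)
Lemma cube_lift_step (m : nat) (y : nat) (w : int) : ~~ (p %| y)%N ->
  (p%:Z ^+ (m + cube_prec) %| y%:Z ^+ 3 - w)%Z ->
  exists2 z : nat, ~~ (p %| z)%N & (p%:Z ^+ (m.+1 + cube_prec) %| z%:Z ^+ 3 - w)%Z.
Proof.
move=> py /dvdzP[A yA].
have [b pb hb] : exists2 b : nat, ~~ (p %| b)%N &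
    3 * p%:Z ^+ m.+1 = b%:Z * p%:Z ^+ (m + cube_prec).
  rewrite /cube_prec; case: eqP => [->|/eqP p3].
    by exists 1%N => //; rewrite addn2 !exprS; ring.
  by exists 3%N; rewrite ?addn1 // dvdn_prime2.
have pby : ~~ (p %| b * y ^ 2)%N by rewrite Euclid_dvdM // Euclid_dvdX // andbT negb_or pb py.
have [k /dvdzP[q kq]] := linear_congruence_int A pby.
exists (y + p ^ m.+1 * k)%N.
  by rewrite dvdn_addl ?py // dvdn_mulr // expnS dvdn_mulr.
rewrite PoszD PoszM PoszX.
set P := p%:Z ^+ m.+1 in hb *.
have -> : (y%:Z + P * k%:Z) ^+ 3 - w =
   (y%:Z ^+ 3 - w) + (3 * P) * (y%:Z ^+ 2 * k%:Z + y%:Z * k%:Z ^+ 2 * P)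
   + P ^+ 3 * k%:Z ^+ 3 by ring.
rewrite yA hb; set Q := p%:Z ^+ (m + cube_prec).
have -> : A * Q + b%:Z * Q * (y%:Z ^+ 2 * k%:Z + y%:Z * k%:Z ^+ 2 * P) + P ^+ 3 * k%:Z ^+ 3 =
   Q * (A + (b * y ^ 2)%:Z * k%:Z) + Q * P * (b%:Z * y%:Z * k%:Z ^+ 2) + P ^+ 3 * k%:Z ^+ 3.
  by rewrite PoszM PoszX; ring.
have -> : p%:Z ^+ (m.+1 + cube_prec) = p%:Z * Q by rewrite addSn exprS.
rewrite kq; apply: rpredD; first apply: rpredD.
- by apply/dvdzP; exists q; ring.
- by apply/dvdzP; exists (p%:Z ^+ m * (b%:Z * y%:Z * k%:Z ^+ 2)); rewrite /P exprS; ring.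
(* This needs m + 1 + cube_prec <= 3 (m + 1), an equality when p = 3 and m = 0. *)
- apply: dvdz_mulr; rewrite /P /Q -exprS -exprM; apply: dvdz_exp2l.
  by rewrite /cube_prec; case: eqP; lia.
Qed.

Lemma cube_lift M y (w : int) : ~~ (p %| y)%N ->
  (p%:Z ^+ cube_prec %| y%:Z ^+ 3 - w)%Z ->
  exists2 z : nat, ~~ (p %| z)%N & (p%:Z ^+ M %| z%:Z ^+ 3 - w)%Z.
Proof.
move=> py yw.
suff [z pz zw] : exists2 z : nat, ~~ (p %| z)%N & (p%:Z ^+ (M + cube_prec) %| z%:Z ^+ 3 - w)%Z.
  by exists z => //; apply: dvdz_trans zw; rewrite dvdz_exp2l // leq_addr.
elim: M => [|M [z pz zw]]; first by exists y.
exact: cube_lift_step zw.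
Qed.

Lemma cube_equation_lift M u y S : ~~ (p %| u)%N -> ~~ (p %| y)%N ->
  (p ^ cube_prec %| u * y ^ 3 + S)%N ->
  exists2 z, ~~ (p %| z)%N & (p ^ M %| u * z ^ 3 + S)%N.
Proof.
move=> pu py uyS; set L := (p ^ (M + cube_prec))%N.
(* [k] is -S/u modulo L, with -S written as S (L - 1) to stay in [nat]. L is a multiple of
   p^cube_prec, where the hypothesis lives, and of p^M, where the conclusion lives. *)
have [k ukS] : exists k, (L %| u * k + S)%N.
  have cop : coprime u L by rewrite coprimeXr // coprime_sym prime_coprime.
  have u_gt0 : (0 < u)%N by case: u pu {cop uyS}; rewrite ?dvdn0.
  exists (chinese u L 0 (S * L.-1) %/ u)%N.
  rewrite mulnC divnK; last by rewrite /dvdn chinese_modl // mod0n.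
  rewrite /dvdn -modnDml chinese_modr // modnDml -[X in (_ + X)%N]muln1 -mulnDr addn1.
  by rewrite prednK ?modnMl // expn_gt0 p_gt0.
have ucan c (x : int) : (p%:Z ^+ c %| u%:Z * x)%Z = (p%:Z ^+ c %| x)%Z.
  apply: Gauss_dvdzr; rewrite coprimezE abszX /=.
  by rewrite coprimeXl // prime_coprime.
have eqk (x : nat) : u%:Z * (x%:Z ^+ 3 - k%:Z) = (u * x ^ 3 + S)%N%:Z - (u * k + S)%N%:Z.
  by rewrite !PoszD (PoszM u (x ^ 3)%N) PoszX (PoszM u k); ring.
have [|z pz zk] := @cube_lift M y k%:Z py.
  rewrite -(ucan cube_prec) eqk; apply: rpredB; rewrite dvdz_pX //.
  by apply: dvdn_trans ukS; rewrite dvdn_exp2l // leq_addl.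
exists z => //; rewrite -dvdz_pX.
have -> : (u * z ^ 3 + S)%N%:Z = u%:Z * (z%:Z ^+ 3 - k%:Z) + (u * k + S)%N%:Z.
  by rewrite eqk subrK.
apply: rpredD; first by rewrite ucan.
by rewrite dvdz_pX; apply: dvdn_trans ukS; rewrite dvdn_exp2l // leq_addr.
Qed.

End CubeLifting.

(** * Reduction of solubility to a congruence *)

Section ReductionCriterion.
Local Open Scope nat_scope.

(* The residue of j' - j modulo 3, for j <= 3. *)
Definition shift_exp j j' := (j' + (3 - j)) %% 3.

(** For a coefficient of valuation v, the factor of K is the power of p by which its variable is
    scaled: it brings the term to the least attainable valuation not below 3K + j. The bound on v
    keeps the truncated subtraction exact. *)
Lemma shift_exp_up v j K : v %/ 3 < K -> j < 3 ->
  v + (K + (v %% 3 < j) - v %/ 3) * 3 = 3 * K + j + shift_exp j (v %% 3).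
Proof.
move: (divn_eq v 3) (ltn_pmod v (isT : 0 < 3)).
move: (v %/ 3) (v %% 3) => k [|[|[|l]]] -> // _ kK;
  by case: j => [|[|[|j]]] //= _; rewrite /shift_exp /=; lia.
Qed.

(** Here v and b are the valuations of a coefficient and of its variable, v0 and b0 those for a term
    of least valuation. The excess splits into its remainder modulo 3, which is the shift, and a
    multiple of 3, which the cube of the variable absorbs. *)
Lemma shift_exp_down v b v0 b0 : v0 + 3 * b0 <= v + 3 * b ->
  v + b * 3 = v0 + 3 * b0 + shift_exp (v0 %% 3) (v %% 3) +
    (v %/ 3 + b - (v0 %/ 3 + b0 + (v %% 3 < v0 %% 3))) * 3.
Proof.
move: (divn_eq v 3) (ltn_pmod v (isT : 0 < 3)).
move: (divn_eq v0 3) (ltn_pmod v0 (isT : 0 < 3)).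
move: (v %/ 3) (v %% 3) (v0 %/ 3) (v0 %% 3).
move=> k [|[|[|l]]] k0 [|[|[|l0]]] -> // _ -> // _;
  by rewrite /shift_exp /=; lia.
Qed.

Variable p : nat.
Hypothesis p_pr : prime p.
Let p_gt0 : 0 < p := prime_gt0 p_pr.
Let c := cube_prec p.

(** Digits beyond level M change r by a multiple of p^M, hence its unit part by a multiple of p^(M -
    v), where M - v >= c. *)
Lemma zdig_unit_part (a : Zp p) M M' :
  let r := zdig a M in
  r != 0 -> logn p r + c <= M -> M <= M' ->
  exists2 U, zdig a M' = p ^ logn p r * U & U = r %/ p ^ logn p r %[mod p ^ c].
Proof.
move=> r r0 vM MM'; set v := logn p r.
have rE : r = r %/ p ^ v * p ^ v by rewrite divnK // pfactor_dvdnn.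
exists (r %/ p ^ v + p ^ (M - v) * (zdig a M' %/ p ^ M)).
  rewrite [LHS](divn_eq _ (p ^ M)) zdig_mod // -/r {1}rE mulnDr addnC [p ^ v * _]mulnC.
  by congr addn; rewrite mulnA -expnD subnKC 1?mulnC //; lia.
have -> : M - v = c + (M - v - c) by lia.
by rewrite expnD -mulnA addnC mulnC modnMDl.
Qed.

Lemma unit_part_ndvd r : r != 0 -> ~~ (p %| r %/ p ^ logn p r).
Proof.
rewrite -lt0n => r0; have [q pq rE] := pfactor_coprime p_pr r0.
by rewrite {1}rE mulnK ?pfactor_gt0 // -prime_coprime.
Qed.


(** The equation divided by a power of p with exponent j modulo 3, the variables being rescaled so
    that the remaining exponents are 0, 1 or 2. A unit is demanded at an index with [J i = j], where
    the coefficient is itself a unit, because that is the variable to which Hensel's lemma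
    applies. *)
Definition reduction_soluble d (J u : 'I_d -> nat) :=
  exists2 j, j < 3 & exists2 y : 'I_d -> nat,
    p ^ c %| \sum_i p ^ shift_exp j (J i) * u i * y i ^ 3 &
    exists2 i, J i = j & ~~ (p %| y i).

Section Family.
Variables (n K : nat) (a : 'I_n.+1 -> Zp p).
Let r i := zdig (a i) (3 * K + c).
Hypothesis r_neq0 : forall i, r i != 0.
Hypothesis r_val : forall i, logn p (r i) < 3 * K.
Let v i := logn p (r i).
Let J i := v i %% 3.
Let u i := r i %/ p ^ v i.

Lemma unit_part_at M' : 3 * K + c <= M' -> exists U : 'I_n.+1 -> nat,
  forall i, zdig (a i) M' = p ^ v i * U i /\ U i = u i %[mod p ^ c].
Proof.
move=> MM'.
have /boolp.choice[U UP] i : exists U, zdig (a i) M' = p ^ v i * U /\ U = u i %[mod p ^ c].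
  have [||U UE Uu] := @zdig_unit_part (a i) (3 * K + c) M' (r_neq0 i) => //; last by exists U.
  by rewrite leq_add2r ltnW // r_val.
by exists U.
Qed.

Let p_c_dvd U i : U = u i %[mod p ^ c] -> ~~ (p %| U).
Proof.
move=> Uu; have pc : p %| p ^ c by rewrite /c /cube_prec; case: eqP => _; rewrite ?expn1 // dvdn_exp.
rewrite /dvdn -(modn_dvdm U pc) Uu modn_dvdm // -/(dvdn _ _).
exact: unit_part_ndvd.
Qed.

(** Only the variable [i0] is lifted; the others keep their values, which leaves a single equation
    for a cube. *)
Lemma reduction_soluble_point : reduction_soluble J u -> diag_has_point 3 a.
Proof.
move=> [j j3 [y ysum [i0 Ji0 py]]].
pose e i := K + (J i < j) - v i %/ 3.
(* Since [e i0 <= K + 1] and the lifted value is a unit, p^(K + 3) does not divide coordinate [i0],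
   uniformly in M; this keeps the limit nonzero. *)
apply: (@diag_has_point_compact p p_pr n 3 a (K + 3)) => M.
pose M' := 3 * K + c + M.
have [U UP] := @unit_part_at M' (leq_addr _ _).
pose Y i := p ^ shift_exp j (J i) * U i * y i ^ 3.
have dsum : p ^ c %| U i0 * y i0 ^ 3 + \sum_(i | i != i0) Y i.
  have -> : U i0 * y i0 ^ 3 = Y i0.
    by rewrite /Y Ji0 /shift_exp subnKC ?modnn ?mul1n // ltnW.
  have <- : \sum_i Y i = Y i0 + \sum_(i | i != i0) Y i by rewrite (bigD1 i0).
  rewrite -(@dvdn_sum_congr _ _ (fun i => p ^ shift_exp j (J i) * u i * y i ^ 3)) // => i.
  by rewrite /Y mulnAC -modnMmr -(UP i).2 modnMmr mulnAC.
have [z pz dz] := cube_equation_lift p_pr M' (p_c_dvd (UP i0).2) py dsum.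
pose x i := p ^ e i * (if i == i0 then z else y i).
have vK i : v i %/ 3 < K by have := r_val i; rewrite -/(v i); lia.
have term i : zdig (a i) M' * x i ^ 3 = p ^ (3 * K + j) *
    (p ^ shift_exp j (J i) * U i * (if i == i0 then z else y i) ^ 3).
  rewrite (UP i).1 /x; set Z := if _ then _ else _; rewrite expnMn -expnM.
  have -> : p ^ v i * U i * (p ^ (e i * 3) * Z ^ 3) = p ^ (v i + e i * 3) * (U i * Z ^ 3).
    by rewrite expnD; ring.
  have -> : p ^ (3 * K + j) * (p ^ shift_exp j (J i) * U i * Z ^ 3) =
      p ^ (3 * K + j + shift_exp j (J i)) * (U i * Z ^ 3) by rewrite [in RHS]expnD; ring.
  congr (p ^ _ * _).
  exact: shift_exp_up.
exists x; split.
  suff: p ^ M' %| \sum_i zdig (a i) M' * x i ^ 3.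
    have MM' : M <= M' by rewrite leq_addl.
    move/(dvdn_trans (dvdn_exp2l p MM')).
    rewrite (@dvdn_sum_congr _ _ _ (fun i => zdig (a i) M * x i ^ 3)) // => i.
    by rewrite -modnMml zdig_mod.
  under eq_bigr do rewrite term.
  rewrite -big_distrr dvdn_mull //= (bigD1 i0) //= eqxx Ji0.
  rewrite {1}/shift_exp subnKC ?modnn ?mul1n ?(ltnW j3) //.
  by under eq_bigr => i /negPf-> do [].
exists i0; rewrite /x eqxx; apply: contra pz.
have -> : K + 3 = e i0 + (K + 3 - e i0).-1.+1.
  by rewrite /e; case: (_ < _) => /=; lia.
rewrite expnD dvdn_pmul2l ?expn_gt0 ?p_gt0 //.
by apply: dvdn_trans; rewrite expnS dvdn_mulr.
Qed.

Lemma point_reduction_soluble : diag_has_point 3 a -> reduction_soluble J u.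
Proof.
move=> [x [[i1 [m xm]] xsum]].
(* The term at [i1] has valuation below 3K + 3m, so dividing by the least valuation of a term leaves
   at least [c] digits of the congruence. *)
pose M := 3 * K + c + 3 * m.
pose X i := zdig (x i) M.
have X1 : X i1 != 0.
  by apply: contra xm => /eqP X0; rewrite -(@zdig_mod p _ _ M) -/(X i1) ?X0 ?mod0n //; lia.
have Xm : logn p (X i1) < m.
  rewrite ltnNge; apply: contra xm => /(dvdn_exp2l p) pm.
  rewrite -(@zdig_mod p _ _ M) -/(X i1); last by lia.
  by apply: (dvdn_trans pm); rewrite pfactor_dvdnn.
pose t i := v i + 3 * logn p (X i).
have [i0 X0 i0min] := @arg_minnP _ i1 (fun i => X i != 0) t X1.
have [U UP] := @unit_part_at M (leq_addr _ _).
exists (J i0); first by rewrite ltn_mod.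
pose e i := v i %/ 3 + logn p (X i) - (v i0 %/ 3 + logn p (X i0) + (J i < J i0)).
pose y i := if X i == 0 then 0 else p ^ e i * (X i %/ p ^ logn p (X i)).
exists y; last first.
  by exists i0 => //; rewrite /y (negPf X0) /e ltnn addn0 subnn mul1n unit_part_ndvd.
have term i : zdig (a i) M * X i ^ 3 = p ^ t i0 * (p ^ shift_exp (J i0) (J i) * U i * y i ^ 3).
  rewrite /y; case: eqP => [->|/eqP Xi]; first by rewrite !muln0.
  rewrite (UP i).1 -{1}(@divnK (p ^ logn p (X i)) (X i)) ?pfactor_dvdnn //.
  set Y := X i %/ _; rewrite !expnMn -!expnM.
  have -> : p ^ v i * U i * (Y ^ 3 * p ^ (logn p (X i) * 3)) =
      p ^ (v i + logn p (X i) * 3) * (U i * Y ^ 3) by rewrite expnD; ring.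
  have -> : p ^ t i0 * (p ^ shift_exp (J i0) (J i) * U i * (p ^ (e i * 3) * Y ^ 3)) =
      p ^ (t i0 + shift_exp (J i0) (J i) + e i * 3) * (U i * Y ^ 3) by rewrite !expnD; ring.
  by congr (p ^ _ * _); apply: shift_exp_down; apply: i0min.
have : p ^ t i0 * p ^ c %| p ^ t i0 * \sum_i p ^ shift_exp (J i0) (J i) * U i * y i ^ 3.
  rewrite big_distrr /=; under eq_bigr do rewrite -term.
  rewrite -expnD; apply: dvdn_trans (_ : p ^ M %| _); last by rewrite /dvdn xsum.
  rewrite dvdn_exp2l // /M; have := i0min _ X1; have := r_val i1.
  by rewrite /t -/(v i1); lia.
rewrite dvdn_pmul2l ?expn_gt0 ?p_gt0 //.
rewrite (@dvdn_sum_congr _ _ _ (fun i => p ^ shift_exp (J i0) (J i) * u i * y i ^ 3)) // => i.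
by rewrite mulnAC -modnMmr (UP i).2 modnMmr mulnAC.
Qed.

End Family.
End ReductionCriterion.

(** * Haar outer measure *)

Section HaarMeasure.
Local Open Scope classical_set_scope.
Variables (R : realType) (p : nat).
Hypothesis p_pr : prime p.
Variable n : nat.
Notation ball := (nat * ('I_n.+1 -> nat))%type.
Let q : R := p%:R.
Let q_gt0 : 0 < q. Proof. by rewrite ltr0n prime_gt0. Qed.
Let q_ge0 : 0 <= q. Proof. exact: ltW. Qed.

Definition ball_vol (b : ball) : R := q ^- (b.1 * n.+1).

Definition cover_vol (c : nat -> ball) : \bar R := (\sum_(0 <= j <oo) (ball_vol (c j))%:E)%E.

Lemma ball_vol_gt0 b : 0 < ball_vol b.
Proof. by rewrite invr_gt0 exprn_gt0. Qed.

Lemma haar_le_cover (S : set ('I_n.+1 -> Zp p)) c :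
  S `<=` \bigcup_j zball (c j) -> (haar R S <= cover_vol c)%E.
Proof. by move=> Sc; apply: ereal_inf_lbound; exists c. Qed.

Lemma le_haar (S : set ('I_n.+1 -> Zp p)) v :
  (forall c, S `<=` \bigcup_j zball (c j) -> (v <= cover_vol c)%E) -> (v <= haar R S)%E.
Proof. by move=> cv; apply: le_ereal_inf_tmp => _ [c [Sc ->]]; apply: cv. Qed.

(* The volume of the part of b inside the ball of radius p^-m around x. *)
Definition trace_vol (b : ball) (m : nat) (x : 'I_n.+1 -> nat) : R :=
  if [forall i, b.2 i == x i %[mod p ^ minn m b.1]] then ball_vol (maxn m b.1, x) else 0.

Lemma trace_vol_ge0 b m x : 0 <= trace_vol b m x.
Proof. by rewrite /trace_vol; case: ifP => // _; rewrite ltW // ball_vol_gt0. Qed.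

(** Balls are nested or disjoint. If b is smaller than the level-m ball, it meets at most one of the
    sub-balls; otherwise it meets all or none of them, and each takes the fraction p^-(n+1). *)
Lemma trace_vol_split b m (x : 'I_n.+1 -> nat) : (forall i, x i < p ^ m)%N ->
  \sum_(k : {ffun 'I_n.+1 -> 'I_p}) trace_vol b m.+1 (fun i => x i + p ^ m * k i)%N
  <= trace_vol b m x.
Proof.
move=> ltx; have [mb|bm] := ltnP m b.1.
- case: (pickP (fun k : {ffun 'I_n.+1 -> 'I_p} =>
    [forall i, b.2 i == x i + p ^ m * k i %[mod p ^ m.+1]]%N)) => [k0 /forallP k0P|nok]; last first.
    rewrite big1 ?trace_vol_ge0 // => k _.
    by rewrite /trace_vol (minn_idPl mb) nok.
  rewrite (bigD1 k0) //= big1 ?addr0 => [|k kk0].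
    rewrite /trace_vol (maxn_idPr mb) (maxn_idPr (ltnW mb)) (minn_idPl mb) (minn_idPl (ltnW mb)).
    have -> : [forall i, b.2 i == x i + p ^ m * k0 i %[mod p ^ m.+1]]%N by apply/forallP.
    rewrite ifT //; apply/forallP => i; have pm : (p ^ m %| p ^ m.+1)%N by rewrite dvdn_exp2l.
    by rewrite -(modn_dvdm (b.2 i) pm) (eqP (k0P i)) modn_dvdm // addnC mulnC modnMDl.
  rewrite /trace_vol (minn_idPl mb) ifF //; apply: contraNF kk0 => /forallP kP.
  apply/eqP/ffunP => i; apply/val_inj => /=.
  have := eqP (kP i); rewrite (eqP (k0P i)).
  have sm (z : 'I_p) : (x i + p ^ m * z < p ^ m.+1)%N.
    by rewrite expnS; have := ltn_ord z; have := ltx i; nia.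
  rewrite !modn_small //; have : (0 < p ^ m)%N by rewrite expn_gt0 prime_gt0.
  by nia.
- have E k : trace_vol b m.+1 (fun i => x i + p ^ m * (k : {ffun 'I_n.+1 -> 'I_p}) i)%N =
      trace_vol b m x * q ^- n.+1.
    rewrite /trace_vol (minn_idPr bm) (minn_idPr (leqW bm)) (maxn_idPl bm) (maxn_idPl (leqW bm)).
    have -> : [forall i, b.2 i == x i + p ^ m * k i %[mod p ^ b.1]]%N =
              [forall i, b.2 i == x i %[mod p ^ b.1]]%N.
      apply: eq_forallb => i; rewrite -(subnKC bm) expnD -mulnA addnC mulnC modnMDl //.
    case: ifP => _; last by rewrite mul0r.
    by rewrite /ball_vol /= mulSn addnC exprD invfM.
  under eq_bigr do rewrite E.
  rewrite sumr_const card_ffun !card_ord -mulr_natr natrX -mulrA mulVf ?mulr1 //.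
  by rewrite expf_neq0 // gt_eqF.
Qed.

(** Descent in place of Heine-Borel: in a cover of total volume below 1, some sub-ball at each
    successive level is still covered by less than its own volume. The limit point of these
    sub-balls lies in some [c j], and at the level of [c j] this ball alone contributes the full
    volume, a contradiction. *)
Lemma le1_cover_vol (c : nat -> ball) :
  [set: 'I_n.+1 -> Zp p] `<=` \bigcup_j zball (c j) -> (1%:E <= cover_vol c)%E.
Proof.
move=> Tc; rewrite leNgt; apply/negP => lt1.
pose P m x := (\sum_(0 <= j <oo) (trace_vol (c j) m x)%:E < (ball_vol (m, x))%:E)%E.
have t0 b m x : (0 <= (trace_vol b m x)%:E)%E by rewrite lee_fin trace_vol_ge0.
have [||a aP] := @Zp_limit p p_pr n.+1 P.
- rewrite /P /ball_vol mul0n expr0 invr1.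
  under eq_eseriesr => j _.
    rewrite /trace_vol min0n max0n expn0 ifT; last by apply/forallP => i; rewrite !modn1.
    over.
  exact: lt1.
- move=> m x ltx Px; apply: contrapT => nok.
  move: Px; rewrite /P ltNge => /negP; apply.
  have -> : (ball_vol (m, x))%:E = (\sum_(k : {ffun 'I_n.+1 -> 'I_p})
      (ball_vol (m.+1, fun i => x i + p ^ m * k i)%N)%:E)%E.
    rewrite sumEFin /ball_vol /= sumr_const card_ffun !card_ord -mulr_natr natrX.
    rewrite mulSn exprD invfM mulrAC mulVf ?mul1r //.
    by rewrite expf_neq0 // gt_eqF.
  apply: (@le_trans _ _ (\sum_(k : {ffun 'I_n.+1 -> 'I_p})
      \sum_(0 <= j <oo) (trace_vol (c j) m.+1 (fun i => x i + p ^ m * k i)%N)%:E)%E).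
    apply: lee_sum => k _; rewrite leNgt; apply/negP => ltk; apply: nok.
    by exists k.
  rewrite -nneseries_sum //; apply: lee_nneseries => [j _ _|j _].
    by rewrite sume_ge0.
  by rewrite sumEFin lee_fin trace_vol_split.
have [j _ aj] := Tc a Logic.I.
have := aP (c j).1; rewrite /P ltNge => /negP; apply.
apply: le_trans (_ : (trace_vol (c j) (c j).1 (fun i => zdig (a i) (c j).1))%:E <= _)%E.
  rewrite lee_fin /trace_vol minnn maxnn ifT //.
  by apply/forallP => i; rewrite (aj i).
rewrite (@nneseriesD1 _ _ j) //; apply: leeDl.
exact: nneseries_ge0.
Qed.

Definition prepend_cover (M : nat) (F : seq (seq nat)) (c : nat -> ball) (j : nat) : ball :=
  if (j < size F)%N then (M, fun i : 'I_n.+1 => nth 0%N (nth [::] F j) i) else c (j - size F)%N.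

Lemma cover_vol_prepend M F c :
  cover_vol (prepend_cover M F c) =
  ((((size F)%:R * q ^- (M * n.+1)))%:E + cover_vol c)%E.
Proof.
have v0 b : (0 <= (ball_vol b)%:E)%E by rewrite lee_fin ltW // ball_vol_gt0.
rewrite {1}/cover_vol (@nneseries_split _ _ _ (size F)) // add0n; congr (_ + _)%E.
  rewrite big_nat_cond (eq_bigr (fun=> (q ^- (M * n.+1))%:E)); last first.
    by move=> j; rewrite andbT /= => jF; rewrite /prepend_cover jF.
  rewrite -big_nat_cond sumEFin sumr_const_nat subn0 mulr_natl //.
rewrite -nneseries_addn //; apply: eq_eseriesr => j _.
by rewrite /prepend_cover ltnNge leq_addl /= addnK.
Qed.

(** Covers are infinite sequences and every ball has positive volume, so a finite cover has to be
    padded by a tail of arbitrarily small total volume. *)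
Lemma tiny_cover (e : R) : 0 < e -> exists c : nat -> ball, (cover_vol c <= e%:E)%E.
Proof.
move=> e0; pose L := (Num.truncn e^-1).+1.
exists (fun j => ((L + j.+1)%N, fun=> 0%N)).
apply: le_trans (@epsilon_trick0 R e xpredT (ltW e0)).
apply: lee_nneseries => [j _ _|j _]; rewrite lee_fin.
  by rewrite ltW // ball_vol_gt0.
have q2 : 2%:R <= q by rewrite ler_nat prime_gt1.
apply: (@le_trans _ _ (2 ^- (L + j.+1))).
  rewrite /ball_vol lef_pV2 ?posrE ?exprn_gt0 //=.
  apply: (@le_trans _ _ (q ^+ (L + j.+1))); first by rewrite lerXn2r // nnegrE.
  by rewrite ler_weXn2l ?leq_pmulr // (le_trans _ q2) // ler1n.
rewrite exprD invfM natrX ler_pM2r ?invr_gt0 ?exprn_gt0 //.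
rewrite -[e]invrK lef_pV2 ?posrE ?exprn_gt0 ?invr_gt0 //.
apply: le_trans (ltW (truncnS_gt _)) _; rewrite -natrX ler_nat.
exact/ltnW/ltn_expl.
Qed.

Lemma haar_le_finite (S : set ('I_n.+1 -> Zp p)) M (F : seq (seq nat)) :
  (forall a, S a -> exists2 s, s \in F & forall i, zdig (a i) M = nth 0%N s i) ->
  (haar R S <= ((size F)%:R * q ^- (M * n.+1))%:E)%E.
Proof.
move=> SF; apply/lee_addgt0Pr => e e0; have [c cP] := tiny_cover e0.
apply: le_trans (haar_le_cover (c := prepend_cover M F c) _) _.
  move=> a /SF[s sF sa]; exists (index s F) => // i.
  by rewrite /prepend_cover index_mem sF /= nth_index.
by rewrite cover_vol_prepend leeD2l.
Qed.

(** A finite cover of the complement placed in front of any cover of S covers the whole space, whose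
    covers have volume at least 1. *)
Lemma haar_ge_finite (S : set ('I_n.+1 -> Zp p)) M (F : seq (seq nat)) :
  (forall a, ~ S a -> exists2 s, s \in F & forall i, zdig (a i) M = nth 0%N s i) ->
  ((1 - (size F)%:R * q ^- (M * n.+1))%:E <= haar R S)%E.
Proof.
move=> SF; apply: le_haar => c Sc.
rewrite EFinB leeBlDl //; rewrite -cover_vol_prepend; apply: le1_cover_vol => a _.
case: (pselect (S a)) => [/Sc[j _ aj]|/SF[s sF sa]].
  by exists (j + size F)%N => // i; rewrite /prepend_cover ltnNge leq_addl /= addnK.
exists (index s F) => // i.
by rewrite /prepend_cover index_mem sF /= nth_index.
Qed.

End HaarMeasure.

(** * Densities from types *)

Section Words.
Variable T : eqType.
Implicit Types A s : seq T.

Fixpoint words A d : seq (seq T) :=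
  if d is d'.+1 then [seq x :: s | x <- A, s <- words A d'] else [:: [::]].

Lemma mem_words A d s : (s \in words A d) = (size s == d) && all (mem A) s.
Proof.
elim: d s => [|d IH] [|x s] //=; first by apply/negbTE/allpairsPdep => -[? [? []]].
apply/allpairsPdep/idP => [[y [t [yA tW [-> ->]]]]|].
  by rewrite yA /=; move: tW; rewrite IH eqSS.
by rewrite eqSS andbCA => /andP[xA sW]; exists x, s; split=> //; rewrite IH.
Qed.

Lemma size_words A d : size (words A d) = (size A ^ d)%N.
Proof. by elim: d => //= d IH; rewrite size_allpairs IH expnS. Qed.

Lemma sum_words_prod (R : comNzRingType) (f : T -> R) A d :
  \sum_(s <- words A d) \prod_(x <- s) f x = (\sum_(x <- A) f x) ^+ d.
Proof.
elim: d => [|d IH] /=; first by rewrite big_seq1 big_nil expr0.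
rewrite big_allpairs_dep exprS -IH big_distrl /=; apply: eq_bigr => x _.
by rewrite big_distrr /=; apply: eq_bigr => s _; rewrite big_cons.
Qed.

Lemma words_tail_closed (bad : pred (seq T)) A m d :
  (forall x s, bad (x :: s) -> bad s) -> (m <= d)%N ->
  ~~ has bad (words A m) -> ~~ has bad (words A d).
Proof.
move=> badS /subnKC <-; elim: (d - m)%N => [|k IH] E; first by rewrite addn0.
apply: contra (IH E) => /hasP[s]; rewrite addnS => /allpairsPdep[x [s' [_ sW ->]]] b.
by apply/hasP; exists s' => //; apply: badS b.
Qed.

End Words.

(** The fibre over a word of types is the product of the fibres over its letters, so its size is the
    product of the counts. *)
Lemma sum_words_map (R : comNzRingType) (T U : eqType) (det : pred T) (ty : T -> U)
    (A : seq T) (B : seq U) d (P : seq U -> R) :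
  uniq B -> (forall x, x \in A -> det x -> ty x \in B) ->
  \sum_(s <- words A d | all det s) P (map ty s) =
  \sum_(s <- words B d) (\prod_(z <- s) (count (fun x => det x && (ty x == z)) A)%:R) * P s.
Proof.
move=> uB AB; elim: d P => [|d IH] P /=.
  by rewrite big_mkcond !big_seq1 /= big_nil mul1r.
rewrite big_mkcond !big_allpairs_dep /=.
pose G z := \sum_(s <- words B d)
  (\prod_(z <- s) (count (fun x => det x && (ty x == z)) A)%:R) * P (z :: s).
transitivity (\sum_(x <- A | det x) G (ty x)).
  rewrite [RHS]big_mkcond; apply: eq_bigr => x _.
  rewrite /G -(IH (fun s => P (ty x :: s))) /=; case: (det x) => /=; last by rewrite big1.
  by rewrite [RHS]big_mkcond.
transitivity (\sum_(z <- B) (count (fun x => det x && (ty x == z)) A)%:R * G z).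
  transitivity (\sum_(x <- A | det x) \sum_(z <- B | ty x == z) G z).
    rewrite big_seq_cond [RHS]big_seq_cond; apply: eq_bigr => x /andP[xA dx].
    rewrite -big_filter (_ : [seq z <- B | ty x == z] = [:: ty x]) ?big_seq1 //.
    rewrite -(filter_pred1_uniq uB (AB _ xA dx)); apply: eq_filter => z.
    by rewrite eq_sym.
  rewrite (exchange_big_dep predT) //=; apply: eq_bigr => z _.
  by rewrite big_const_seq iter_addr addr0 mulr_natl.
apply: eq_bigr => z _; rewrite /G big_distrr /=; apply: eq_bigr => s _.
by rewrite big_cons mulrA.
Qed.

Arguments words : simpl never.

Section CountingResidues.
Local Open Scope nat_scope.

Lemma count_iota_multiples (P : pred nat) a m : 0 < a ->
  count (fun r => (a %| r) && P (r %/ a)) (iota 0 (a * m)) = count P (iota 0 m).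
Proof.
move=> a0; elim: m => [|m IH]; first by rewrite muln0.
rewrite mulnS addnC iotaD count_cat IH -addn1 iotaD count_cat /= !add0n; congr (_ + _).
case: a a0 {IH} => // a _ /=; rewrite dvdn_mulr // mulKn //= addn0.
rewrite -[RHS]addn0; congr (_ + _); apply/eqP; rewrite -leqn0 leqNgt -has_count.
apply/negP => /hasP[r]; rewrite mem_iota => rI /andP[/dvdnP[k rE] _].
by move: rI; rewrite rE; have [km|km] := leqP k m; nia.
Qed.

Lemma count_iota_periodic (P : pred nat) b m : (forall r, P (r %% b) = P r) ->
  count P (iota 0 (b * m)) = m * count P (iota 0 b).
Proof.
move=> Pb; elim: m => [|m IH]; first by rewrite muln0 mul0n.
rewrite mulnS addnC iotaD count_cat IH add0n mulSn addnC; congr (_ + _).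
rewrite -[b * m]addn0 iotaDl count_map; apply: eq_count => r /=.
by rewrite -Pb mulnC modnMDl Pb.
Qed.

Lemma count_sum_pred (T : Type) (a : pred T) s : count a s = \sum_(x <- s) a x.
Proof. by rewrite -sum1_count big_mkcond; apply: eq_bigr => x _; case: (a x). Qed.

End CountingResidues.

Section Density.
Variables (R : realType) (p : nat).
Hypothesis p_pr : prime p.
Let c := cube_prec p.
Let q : R := p%:R.
Variables (N : nat) (cls : nat -> nat).
Hypothesis N_gt0 : (0 < N)%N.
Hypothesis cls_mod : forall u, cls (u %% p ^ c)%N = cls u.
Hypothesis cls_lt : forall u, ~~ (p %| u)%N -> (cls u < N)%N.
Hypothesis cls_card : forall k, (k < N)%N ->
  (count (fun u => ~~ (p %| u)%N && (cls u == k)) (iota 0 (p ^ c)) * N = p ^ c.-1 * p.-1)%N.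

Let p_gt0 : (0 < p)%N := prime_gt0 p_pr.
Let q_gt1 : 1 < q. Proof. by rewrite ltr1n prime_gt1. Qed.
Let q_neq0 : q != 0. Proof. by rewrite gt_eqF // (lt_trans ltr01). Qed.
Let c_gt0 : (0 < c)%N. Proof. by rewrite /c /cube_prec; case: eqP. Qed.

Definition types : seq (nat * nat) := [seq (j, k) | j <- iota 0 3, k <- iota 0 N].

Definition type_weight (z : nat * nat) : R :=
  q ^- z.1 * ((1 - q^-1) / (1 - q ^- 3)) / N%:R.

(** At level 3K + c, a valuation below 3K leaves more than [c] digits of the unit, enough to read
    off its class. Zero is excluded explicitly because [logn p 0 = 0]. *)
Definition determined K r := (r != 0%N) && (logn p r < 3 * K)%N.

Definition residue_type r : nat * nat :=
  (logn p r %% 3, cls (r %/ p ^ logn p r))%N.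

Lemma uniq_types : uniq types.
Proof. by apply: allpairs_uniq; rewrite ?iota_uniq // => -[? ?] [? ?]. Qed.

Lemma residue_type_in K r : determined K r -> residue_type r \in types.
Proof.
case/andP => r0 _; apply/allpairsPdep; exists (logn p r %% 3)%N, (cls (r %/ p ^ logn p r)).
by rewrite !mem_iota /= ltn_mod add0n cls_lt // unit_part_ndvd.
Qed.

Lemma valuation_eq r v : (r != 0%N) && (logn p r == v) =
  (p ^ v %| r)%N && ~~ (p %| r %/ p ^ v)%N.
Proof.
have [->|r0] /= := eqVneq r 0%N; first by rewrite dvdn0 div0n dvdn0.
apply/eqP/andP => [<-|[/dvdnP[k rE] pk]].
  by rewrite pfactor_dvdnn unit_part_ndvd.
move: r0 pk; rewrite rE mulnK ?expn_gt0 ?p_gt0 // muln_eq0 negb_or -lt0n => /andP[k0 _] pk.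
by rewrite lognM ?expn_gt0 ?p_gt0 // pfactorK // lognE p_pr k0 (negPf pk).
Qed.

Lemma type_weight_sum : \sum_(z <- types) type_weight z = 1.
Proof.
rewrite big_allpairs_dep /type_weight /=.
under eq_bigr => j _.
  rewrite big_const_seq count_predT size_iota.
  rewrite (_ : iter _ _ _ = q ^- j * ((1 - q^-1) / (1 - q ^- 3))); last first.
    by rewrite iter_addr addr0 -(mulr_natr (_ / _)) divfK // pnatr_eq0 -lt0n.
  over.
rewrite /= !big_cons big_nil; field.
by rewrite q_neq0 subr_eq0 gt_eqF // exprn_egt1.
Qed.

Lemma type_weight_ge0 z : 0 <= type_weight z.
Proof.
rewrite /type_weight !mulr_ge0 ?invr_ge0 ?ler0n ?exprn_ge0 //.
- by rewrite subr_ge0 invf_le1 // ?(lt_trans ltr01) // ltW.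
- by rewrite subr_ge0 invf_le1 ?exprn_gt0 ?(lt_trans ltr01) // exprn_ege1 // ltW.
Qed.

(** Truncating the valuation at a multiple of 3 gives every type exactly K terms of its geometric
    series. All types thus lose the same factor 1 - q^(-3K), and their proportions among determined
    residues are exact. *)
Lemma count_residue_type K z : z \in types ->
  (count (fun r => determined K r && (residue_type r == z)) (iota 0 (p ^ (3 * K + c))))%:R
  = q ^+ (3 * K + c) * type_weight z * (1 - q ^- (3 * K)).
Proof.
case/allpairsPdep => j [k [+ + ->]]; rewrite !mem_iota !add0n /= => j3 kN.
set e := count (fun u => ~~ (p %| u)%N && (cls u == k)) (iota 0 (p ^ c)).
(* Residues of valuation v are p^v u with u below p^(c + 3K - v); the condition on u has period
   p^c. *)
have cntv v : (v < 3 * K)%N ->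
    count (fun r => (p ^ v %| r) && (~~ (p %| r %/ p ^ v) && (cls (r %/ p ^ v) == k)))%N
      (iota 0 (p ^ (3 * K + c))) = (p ^ (3 * K - v) * e)%N.
  move=> vK; have -> : (3 * K + c = v + (c + (3 * K - v)))%N by lia.
  rewrite !expnD (@count_iota_multiples (fun u => ~~ (p %| u)%N && (cls u == k))); last first.
    by rewrite expn_gt0 p_gt0.
  apply: count_iota_periodic => r; rewrite cls_mod /dvdn modn_dvdm //.
  by rewrite -{1}[p]expn1 dvdn_exp2l.
have -> : count (fun r => determined K r && (residue_type r == (j, k))) (iota 0 (p ^ (3 * K + c)))
    = (\sum_(i < K) p ^ (3 * K - (3 * i + j)) * e)%N.
  transitivity (\sum_(i < K) count (fun r => (p ^ (3 * i + j) %| r) &&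
     (~~ (p %| r %/ p ^ (3 * i + j)) && (cls (r %/ p ^ (3 * i + j)) == k)))
      (iota 0 (p ^ (3 * K + c))))%N; last first.
    by apply: eq_bigr => i _; rewrite cntv //; have := ltn_ord i; lia.
  rewrite count_sum_pred; under [RHS]eq_bigr do rewrite count_sum_pred.
  rewrite exchange_big /=; apply: eq_bigr => r _.
  under eq_bigr do rewrite andbA -valuation_eq.
  rewrite /determined /residue_type xpair_eqE.
  have [->|r0] /= := eqVneq r 0%N; first by rewrite big1.
  have [vK|Kv] /= := ltnP (logn p r) (3 * K); last first.
    by rewrite big1 // => i _; have := ltn_ord i; case: (logn p r =P _) => //= vi; lia.
  have [vj|vj] /= := eqVneq (logn p r %% 3)%N j; last first.
    by rewrite big1 // => i _; case: (logn p r =P _) => //= vi; move: vj; rewrite vi; lia.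
  have iK : (logn p r %/ 3 < K)%N by lia.
  have vE : logn p r = (3 * (Ordinal iK) + j)%N by rewrite /=; lia.
  rewrite (bigD1 (Ordinal iK)) //= -vE eqxx /= big1 ?addn0 // => i ii.
  case: (logn p r =P _) => //= vi; case/eqP: ii; apply: val_inj => /=; lia.
rewrite natr_sum.
under eq_bigr => i _.
  rewrite natrM natrX (_ : _ ^+ _ = q ^+ (3 * K) * q ^- j * (q ^- 3) ^+ i); last first.
    rewrite exprVn -exprM -mulrA -invfM -exprD.
    have {2}-> : (3 * K = 3 * K - (3 * i + j) + (j + 3 * i))%N by have := ltn_ord i; lia.
    by rewrite exprD mulfK // expf_neq0.
  over.
rewrite -mulr_suml -mulr_sumr.
have q3 : q ^- 3 < 1 by rewrite invf_lt1 ?exprn_gt0 ?exprn_egt1 // (lt_trans ltr01).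
have := @subrX1 _ (q ^- 3) K; rewrite exprVn -exprM.
set S := \sum_(i < K) _ => SE.
have -> : S = (1 - q ^- (3 * K)) / (1 - q ^- 3).
  apply: (mulIf (x := 1 - q ^- 3)); first by rewrite subr_eq0 gt_eqF.
  rewrite divfK; last by rewrite subr_eq0 gt_eqF.
  by rewrite -[RHS]opprB SE -mulNr opprB mulrC.
have eE : e%:R = q ^+ c.-1 * (q - 1) / N%:R :> R.
  apply: (mulIf (x := N%:R)); first by rewrite pnatr_eq0 -lt0n.
  by rewrite divfK ?pnatr_eq0 -?lt0n // -natrM cls_card // natrM natrX -(subn1 p) natrB //.
rewrite eE /type_weight /=.
have -> : (3 * K + c = 3 * K + c.-1.+1)%N by lia.
rewrite exprD [q ^+ c.-1.+1]exprSr.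
have -> : q - 1 = q * (1 - q^-1) by rewrite mulrBr mulr1 divff.
move: (q ^- (3 * K)) (q ^+ (3 * K)) (q ^+ c.-1) (1 - q^-1) (1 - q ^- 3)^-1 (q ^- j) N%:R^-1.
by move=> *; ring.
Qed.


Section BadTypes.
Variables (n : nat) (bad : pred (seq (nat * nat))).
Hypothesis badP : forall J u : 'I_n.+1 -> nat,
  (forall i, J i < 3)%N -> (forall i, ~~ (p %| u i))%N ->
  reduction_soluble p J u <-> ~~ bad [seq (J i, cls (u i)) | i <- enum 'I_n.+1].

Definition bad_weight : R :=
  \sum_(s <- words types n.+1 | bad s) \prod_(z <- s) type_weight z.

Definition residue_words K := words (iota 0 (p ^ (3 * K + c))) n.+1.

Lemma count_residue_words K (P : pred (seq (nat * nat))) :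
  (count (fun s => all (determined K) s && P (map residue_type s)) (residue_words K))%:R =
  q ^+ ((3 * K + c) * n.+1) * (1 - q ^- (3 * K)) ^+ n.+1 *
  \sum_(s <- words types n.+1 | P s) \prod_(z <- s) type_weight z.
Proof.
have -> : (count (fun s => all (determined K) s && P (map residue_type s)) (residue_words K))%:R
    = \sum_(s <- residue_words K | all (determined K) s) (P (map residue_type s))%:R :> R.
  rewrite count_sum_pred natr_sum [RHS]big_mkcond /=; apply: eq_bigr => s _.
  by case: (all _ s).
rewrite (sum_words_map _ (fun s => (P s)%:R) uniq_types); last first.
  by move=> x _; apply: residue_type_in.
rewrite [in RHS]big_mkcond big_distrr /= big_seq_cond [RHS]big_seq_cond.
apply: eq_bigr => s /andP[+ _]; rewrite mem_words => /andP[/eqP <- /allP sT].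
case: (P s); last by rewrite !mulr0.
rewrite mulr1 exprM -exprMn.
rewrite big_seq_cond (eq_bigr (fun z => (q ^+ (3 * K + c) * (1 - q ^- (3 * K))) * type_weight z)).
  rewrite -big_seq_cond; elim: s {sT} => [|x s IH]; first by rewrite !big_nil mul1r.
  by rewrite !big_cons IH exprS mulrACA.
by move=> z; rewrite andbT => /sT zT; rewrite count_residue_type // mulrAC.
Qed.

Lemma size_residue_words K : (size (residue_words K))%:R = q ^+ ((3 * K + c) * n.+1).
Proof. by rewrite size_words size_iota natrX natrX exprM. Qed.

Lemma residue_word_mem K (a : 'I_n.+1 -> Zp p) :
  [seq zdig (a i) (3 * K + c) | i <- enum 'I_n.+1] \in residue_words K.
Proof.
rewrite mem_words size_map size_enum_ord eqxx /=; apply/allP => _ /mapP[i _ ->].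
by rewrite /= mem_iota add0n zdig_lt.
Qed.

Lemma nth_residue_word K (a : 'I_n.+1 -> Zp p) (i : 'I_n.+1) :
  nth 0%N [seq zdig (a i) (3 * K + c) | i <- enum 'I_n.+1] i = zdig (a i) (3 * K + c).
Proof. by rewrite (nth_map i) ?size_enum_ord // nth_ord_enum. Qed.

Lemma residue_word_bad K (a : 'I_n.+1 -> Zp p) :
  let s := [seq zdig (a i) (3 * K + c) | i <- enum 'I_n.+1] in
  all (determined K) s -> diag_has_point 3 a <-> ~~ bad (map residue_type s).
Proof.
move=> s /allP ds.
have di i : determined K (zdig (a i) (3 * K + c)).
  by apply: ds; apply/mapP; exists i => //; rewrite mem_enum.
have r0 i : zdig (a i) (3 * K + c) != 0%N by case/andP: (di i).
have rv i : (logn p (zdig (a i) (3 * K + c)) < 3 * K)%N by case/andP: (di i).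
rewrite -map_comp -(@badP (fun i => logn p (zdig (a i) (3 * K + c)) %% 3)%N
  (fun i => zdig (a i) (3 * K + c) %/ p ^ logn p (zdig (a i) (3 * K + c)))%N).
- split; [exact: (point_reduction_soluble p_pr r0 rv)|exact: (reduction_soluble_point p_pr r0 rv)].
- by move=> i; rewrite ltn_mod.
- by move=> i; apply: unit_part_ndvd.
Qed.

Lemma uncovered_fraction K (P : pred (seq (nat * nat))) :
  (size [seq s <- residue_words K | ~~ (all (determined K) s && P (map residue_type s))])%:R
    * q ^- ((3 * K + c) * n.+1) =
  1 - (1 - q ^- (3 * K)) ^+ n.+1 *
    \sum_(s <- words types n.+1 | P s) \prod_(z <- s) type_weight z.
Proof.
have q0 : q ^+ ((3 * K + c) * n.+1) != 0 by rewrite expf_neq0.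
rewrite size_filter; have := count_predC
  (fun s => all (determined K) s && P (map residue_type s)) (residue_words K).
move/(congr1 (fun k : nat => k%:R : R)); rewrite natrD size_residue_words => /(canRL (addKr _)) ->.
rewrite count_residue_words; move: q0.
move: (q ^+ ((3 * K + c) * n.+1)) (\sum_(s <- _ | _) _) ((1 - _) ^+ _) => Q W A Q0.
by field.
Qed.

Lemma bernoulli_le (x : R) d : 0 <= x <= 1 -> 1 - d%:R * x <= (1 - x) ^+ d.
Proof.
case/andP => x0 x1; elim: d => [|d IH]; first by rewrite mul0r subr0.
rewrite exprS; apply: le_trans (_ : (1 - x) * (1 - d%:R * x) <= _); last first.
  by rewrite ler_wpM2l // subr_ge0.
rewrite -natr1 -subr_ge0.
have -> : (1 - x) * (1 - d%:R * x) - (1 - (d%:R + 1) * x) = d%:R * x ^+ 2 by ring.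
by rewrite mulr_ge0 // sqr_ge0.
Qed.

(** The cover from above omits the words that are determined and bad, the cover of the complement
    omits those that are determined and good. Each omitted weight is its limit times (1 -
    q^(-3K))^(n+1). *)
Lemma rho_bad_weight : rho R p n 3 = (1 - bad_weight)%:E.
Proof.
have W0 (P : pred (seq (nat * nat))) :
    0 <= \sum_(s <- words types n.+1 | P s) \prod_(z <- s) type_weight z.
  by apply: sumr_ge0 => s _; apply: prodr_ge0 => z _; apply: type_weight_ge0.
have good : \sum_(s <- words types n.+1 | ~~ bad s) \prod_(z <- s) type_weight z = 1 - bad_weight.
  have := sum_words_prod type_weight types n.+1; rewrite type_weight_sum expr1n.
  by rewrite (bigID bad) => /(canRL (addKr _)) ->; rewrite addrC.
have bw1 : bad_weight <= 1 by rewrite -subr_ge0 -good.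
have epsK (e : R) : 0 < e -> exists K, 1 - e <= (1 - q ^- (3 * K)) ^+ n.+1.
  (* K exceeds (n + 1)/e and q^(3K) >= K, so the Bernoulli error (n + 1) q^(-3K) is at most e. *)
  move=> e0; pose K := (Num.truncn (n.+1%:R / e)).+1; exists K.
  have qK : K%:R <= q ^+ (3 * K).
    rewrite -natrX ler_nat; apply: (leq_trans (ltnW (ltn_expl K (prime_gt1 p_pr)))).
    by rewrite leq_exp2l ?prime_gt1 // leq_pmull.
  have qpos : 0 < q ^+ (3 * K) by rewrite exprn_gt0 // (lt_trans ltr01).
  apply: le_trans (bernoulli_le _ _); last first.
    by rewrite invr_ge0 ltW //= invf_le1 // exprn_ege1 // ltW.
  rewrite lerD2l lerN2 ler_pdivrMr // mulrC -ler_pdivrMr //.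
  by apply: le_trans qK; apply/ltW/truncnS_gt.
apply/eqP; rewrite eq_le; apply/andP; split; apply/lee_addgt0Pr => e e0;
  have [K eK] := epsK e e0.
- have le_rho : (rho R p n 3 <= ((size [seq s <- residue_words K |
      ~~ (all (determined K) s && bad (map residue_type s))])%:R * q ^- ((3 * K + c) * n.+1))%:E)%E.
    apply: haar_le_finite => // a Sa.
    exists [seq zdig (a i) (3 * K + c) | i <- enum 'I_n.+1]; last first.
      by move=> i; rewrite nth_residue_word.
    rewrite mem_filter residue_word_mem andbT; apply/negP => /andP[ds b].
    by have /negP := (residue_word_bad ds).1 Sa.
  apply: (le_trans le_rho); rewrite uncovered_fraction -EFinD lee_fin -/bad_weight.
  have : (1 - e) * bad_weight <= (1 - q ^- (3 * K)) ^+ n.+1 * bad_weight.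
    by rewrite ler_wpM2r // W0.
  by have := W0 bad; rewrite -/bad_weight; nra.
- have ge_rho : ((1 - (size [seq s <- residue_words K | ~~ (all (determined K) s &&
      ~~ bad (map residue_type s))])%:R * q ^- ((3 * K + c) * n.+1))%:E <= rho R p n 3)%E.
    apply: haar_ge_finite => // a nSa.
    exists [seq zdig (a i) (3 * K + c) | i <- enum 'I_n.+1]; last first.
      by move=> i; rewrite nth_residue_word.
    rewrite mem_filter residue_word_mem andbT; apply/negP => /andP[ds b].
    by apply: nSa; apply/(residue_word_bad ds).
  rewrite -leeBlDr //; apply: le_trans ge_rho.
  rewrite (uncovered_fraction K (fun s => ~~ bad s)) good -EFinB lee_fin.
  have : (1 - e) * (1 - bad_weight) <= (1 - q ^- (3 * K)) ^+ n.+1 * (1 - bad_weight).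
    by rewrite ler_wpM2r // subr_ge0.
  by have := W0 bad; rewrite -/bad_weight; nra.
Qed.

End BadTypes.
End Density.

(** * Solubility modulo p *)

Lemma uniq_map_enumP (I : finType) (T : eqType) (f : I -> T) :
  reflect (injective f) (uniq [seq f i | i <- enum I]).
Proof. exact: injectiveP. Qed.

Lemma uniq_map_enumPn (I : finType) (T : eqType) (f : I -> T) :
  ~~ uniq [seq f i | i <- enum I] -> exists i i', i != i' /\ f i = f i'.
Proof. by case/injectivePn => i [i' ? ?]; exists i, i'. Qed.

Definition bad_types (C : pred (seq nat)) (s : seq (nat * nat)) : bool :=
  uniq s && C (map fst s).

Lemma count_map_enum d (J k : 'I_d -> nat) j :
  count_mem j (map fst [seq (J i, k i) | i <- enum 'I_d]) = #|[set i | J i == j]|.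
Proof.
rewrite -map_comp count_map -sum1_count -sum1_card big_enum_cond.
by apply: eq_bigl => i; rewrite !inE.
Qed.

Section FieldReduction.
Variable p : nat.
Hypothesis p_pr : prime p.
Hypothesis p_neq3 : p != 3%N.
Variables (d : nat) (J u : 'I_d -> nat).
Hypothesis J_lt3 : forall i, (J i < 3)%N.
Hypothesis u_unit : forall i, ~~ (p %| u i)%N.
Let U i : 'F_p := (u i)%:R.

Lemma natr_Fp_eq0 m : (m%:R == 0 :> 'F_p) = (p %| m)%N.
Proof. by rewrite -(dvdn_pcharf (pchar_Fp p_pr)). Qed.

Let U_neq0 i : U i != 0. Proof. by rewrite natr_Fp_eq0. Qed.

(** For p other than 3 the modulus is p itself, and a term with [J i != j] carries a positive power
    of p; so each residue j gives a separate equation over F_p. *)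
Lemma reduction_soluble_Fp : reduction_soluble p J u <->
  exists2 j, (j < 3)%N & exists2 y : 'I_d -> 'F_p,
    \sum_(i | J i == j) U i * y i ^+ 3 = 0 & exists2 i, J i = j & y i != 0.
Proof.
have c1 : cube_prec p = 1%N by rewrite /cube_prec (negPf p_neq3).
have sumE j (y : 'I_d -> nat) : (j < 3)%N ->
    (p ^ cube_prec p %| \sum_i p ^ shift_exp j (J i) * u i * y i ^ 3)%N =
    (\sum_(i | J i == j) U i * (y i)%:R ^+ 3 == 0).
  move=> j3; rewrite c1 expn1 -natr_Fp_eq0 natr_sum; congr (_ == _).
  rewrite [RHS]big_mkcond; apply: eq_bigr => i _; rewrite !natrM !natrX.
  case: eqP => [->|/eqP Jj].
    by rewrite /shift_exp subnKC ?modnn ?mul1r // ltnW.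
  have -> : shift_exp j (J i) = (shift_exp j (J i)).-1.+1.
    rewrite prednK // /shift_exp; move: Jj (J_lt3 i) j3; move: (J i) => l.
    by case: l => [|[|[|]]] //; case: j => [|[|[|]]].
  by rewrite exprS (pcharf0 (pchar_Fp p_pr)) !mul0r.
split=> -[j j3 [y ysum [i Ji yi]]]; exists j => //.
  exists (fun i => (y i)%:R); first by apply/eqP; rewrite -sumE.
  by exists i => //; rewrite natr_Fp_eq0.
exists (fun i => nat_of_ord (y i)); last by exists i => //; rewrite -natr_Fp_eq0 natr_Zp.
by rewrite sumE //; under eq_bigr do rewrite natr_Zp; apply/eqP.
Qed.

Lemma soluble_of_seq j (l : seq 'I_d) (f : 'I_d -> 'F_p) i : uniq l ->
  {in l, forall i, J i = j} -> i \in l -> f i != 0 ->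
  \sum_(i <- l) U i * f i ^+ 3 = 0 -> reduction_soluble p J u.
Proof.
move=> ul lJ il fi fsum; apply/reduction_soluble_Fp.
exists j; first by rewrite -(lJ i il).
exists (fun i => if i \in l then f i else 0); last by exists i; rewrite ?lJ ?il.
rewrite -[RHS]fsum big_uniq // big_mkcond [RHS]big_mkcond; apply: eq_bigr => k _.
case kl: (k \in l); first by rewrite (lJ k kl) eqxx.
by rewrite expr0n mulr0 if_same.
Qed.

Lemma soluble_of_pair i i' z : i != i' -> J i = J i' ->
  U i * z ^+ 3 = U i' -> reduction_soluble p J u.
Proof.
move=> ii' JJ zE; have i'i : (i' == i) = false by rewrite eq_sym; apply: negbTE.
apply: (@soluble_of_seq (J i) [:: i; i'] (fun k => if k == i then z else -1) i').
- by rewrite /= inE ii'.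
- by move=> k; rewrite !inE => /orP[] /eqP->.
- by rewrite !inE eqxx orbT.
- by rewrite i'i oppr_eq0 oner_eq0.
- rewrite big_cons big_seq1 eqxx i'i zE.
  by rewrite -signr_odd /= expr1 mulrN1 subrr.
Qed.

End FieldReduction.

(** * Primes congruent to 2 modulo 3: every element of F_p is a cube *)

Section TwoModThree.
Variable p : nat.
Hypothesis p_pr : prime p.
Hypothesis p_mod : (p %% 3 = 2)%N.

Lemma Fp_cube_root (x : 'F_p) : exists z, z ^+ 3 = x.
Proof.
(* The exponent is (2p - 1)/3, an inverse of 3 modulo p - 1. *)
exists (x ^+ (2 * (p %/ 3) + 1)%N); rewrite -exprM.
have xp : x ^+ p = x by have := expf_card x; rewrite card_Fp.
have -> : ((2 * (p %/ 3) + 1) * 3 = p + p.-1)%N by have := prime_gt0 p_pr; lia.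
by rewrite exprD xp -exprS prednK // prime_gt0.
Qed.

Lemma bad_two_mod_three d (J u : 'I_d -> nat) :
  (forall i, J i < 3)%N -> (forall i, ~~ (p %| u i))%N ->
  reduction_soluble p J u <-> ~~ bad_types predT [seq (J i, 0%N) | i <- enum 'I_d].
Proof.
rewrite /bad_types andbT => J3 pu; have p3 : p != 3%N by apply: contra_eqN p_mod => /eqP ->.
have U0 i : (u i)%:R != 0 :> 'F_p by rewrite natr_Fp_eq0.
split.
  move/(reduction_soluble_Fp p_pr p3 u J3) => [j j3 [y ysum [i Ji yi]]].
  apply/negP => /uniq_map_enumP Jinj; move: ysum.
  rewrite (bigD1 i) /= ?Ji // big1 ?addr0 => [/eqP|k /andP[/eqP Jk]].
    by rewrite mulf_eq0 (negPf (U0 i)) expf_eq0 (negPf yi).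
  by rewrite -Ji in Jk; rewrite (Jinj k i) ?Jk ?eqxx.
move/uniq_map_enumPn => [i [i' [ii' [JJ]]]].
have [z zE] := Fp_cube_root ((u i')%:R / (u i)%:R).
by apply: (soluble_of_pair p_pr p3 J3 ii' JJ (z := z)); rewrite zE mulrC divfK.
Qed.

End TwoModThree.

(** * Primes congruent to 1 modulo 3: three cubic classes in F_p *)

Section OneModThree.
Variable p : nat.
Hypothesis p_pr : prime p.
Hypothesis p_mod : (p %% 3 = 1)%N.
Let p_gt1 : (1 < p)%N := prime_gt1 p_pr.

Lemma Fp_prim_root : exists g : 'F_p, p.-1.-primitive_root g.
Proof.
pose rs := [seq x <- enum 'F_p | x != 0].
have : has p.-1.-primitive_root rs.
  apply: has_prim_root; first by rewrite -subn1 subn_gt0.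
  - apply/allP => x; rewrite mem_filter => /andP[x0 _]; apply/unity_rootP.
    apply: (mulfI x0); rewrite -exprS prednK ?prime_gt0 // mulr1.
    by have := expf_card x; rewrite card_Fp.
  - by rewrite filter_uniq // enum_uniq.
  - rewrite size_filter; have := count_predC (pred1 (0 : 'F_p)) (enum 'F_p).
    rewrite -cardE card_Fp // (count_uniq_mem _ (enum_uniq _)) mem_enum inE /= add1n.
    by move=> pE; rewrite -[X in (X.-1 <= _)%N]pE /=.
by case/hasP => g _; exists g.
Qed.

Variable g : 'F_p.
Hypothesis g_prim : p.-1.-primitive_root g.

Definition dlog (x : 'F_p) : nat := index x [seq g ^+ i | i <- iota 0 p.-1].
Definition cube_class (x : 'F_p) : nat := (dlog x %% 3)%N.

Lemma dlog_lt x : x != 0 -> (dlog x < p.-1)%N.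
Proof.
move=> x0; have xp : x ^+ p.-1 = 1.
  apply: (mulfI x0); rewrite -exprS prednK ?prime_gt0 // mulr1.
  by have := expf_card x; rewrite card_Fp.
have [i ->] := prim_rootP g_prim xp.
rewrite -[X in (_ < X)%N](size_iota 0) -(size_map (fun i => g ^+ i)) index_mem.
by apply/mapP; exists (nat_of_ord i) => //; rewrite mem_iota /=.
Qed.

Lemma dlogK x : x != 0 -> g ^+ dlog x = x.
Proof.
move=> x0; have lx := dlog_lt x0.
have := lx; rewrite -[X in (_ < X)%N](size_iota 0) -(size_map (fun i => g ^+ i)) index_mem => xs.
by rewrite -[RHS](nth_index 0 xs) (nth_map 0%N) ?size_iota // nth_iota.
Qed.

Let p1_mod3 : (3 %| p.-1)%N. Proof. by rewrite /dvdn; have := p_gt1; lia. Qed.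

Lemma prim_root_neq0 : g != 0.
Proof.
apply/eqP => g0; have := prim_expr_order g_prim; rewrite g0 expr0n gtn_eqF.
  by move/eqP; rewrite eq_sym oner_eq0.
by rewrite -subn1 subn_gt0.
Qed.

Lemma cube_class_exp i : cube_class (g ^+ i) = (i %% 3)%N.
Proof.
have /eqP := dlogK (expf_neq0 i prim_root_neq0).
rewrite (eq_prim_root_expr g_prim) => /eqP E.
by rewrite /cube_class -(modn_dvdm _ p1_mod3) E modn_dvdm.
Qed.

Lemma cube_classM x y : x != 0 -> y != 0 ->
  cube_class (x * y) = ((cube_class x + cube_class y) %% 3)%N.
Proof.
move=> x0 y0; rewrite -{1}(dlogK x0) -{1}(dlogK y0) -exprD cube_class_exp.
by rewrite /cube_class modnDml modnDmr.
Qed.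

Lemma cube_class_lt x : (cube_class x < 3)%N. Proof. by rewrite ltn_mod. Qed.

Lemma cube_class_cube x z : x != 0 -> z != 0 -> cube_class (x * z ^+ 3) = cube_class x.
Proof.
move=> x0 z0; rewrite -{1}(dlogK x0) -{1}(dlogK z0) -exprM -exprD cube_class_exp.
by rewrite /cube_class addnC modnMDl.
Qed.

Lemma cube_classN x : x != 0 -> cube_class (- x) = cube_class x.
Proof.
move=> x0; rewrite -[RHS](@cube_class_cube x (-1)) ?oppr_eq0 ?oner_eq0 //.
by rewrite -signr_odd /= expr1 mulrN1.
Qed.

Lemma cube_class_eq x y : x != 0 -> y != 0 -> cube_class x = cube_class y ->
  exists2 z, z != 0 & x * z ^+ 3 = y.
Proof.
move=> x0 y0 xy; have := dlog_lt x0; have := p1_mod3.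
move: xy; rewrite /cube_class => xy p1 lx.
(* A cube root of y/x: the summand (p - 1) [dlog x] avoids truncated subtraction, is invisible as an
   exponent of [g], and is divisible by 3; equality of classes makes the whole exponent divisible by
   3. *)
exists (g ^+ ((dlog y + p.-1 * dlog x - dlog x) %/ 3)); first by rewrite expf_neq0 ?prim_root_neq0.
rewrite -exprM -{1}(dlogK x0) -exprD.
have -> : (dlog x + (dlog y + p.-1 * dlog x - dlog x) %/ 3 * 3 = dlog y + p.-1 * dlog x)%N.
  have [m pm] : exists m, (p.-1 = 3 * m)%N by exists (p.-1 %/ 3)%N; rewrite mulnC divnK.
  have : (p.-1 * dlog x = 3 * (m * dlog x))%N by rewrite pm mulnA.
  have : (dlog x <= p.-1 * dlog x)%N by rewrite leq_pmull //; lia.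
  move: (p.-1 * dlog x)%N (m * dlog x)%N => a b; lia.
by rewrite exprD exprM (prim_expr_order g_prim) expr1n mulr1 dlogK.
Qed.

(* With (i, j) the number of z of class i such that z + 1 has class j,
   the symmetries z -> -1 - z and z -> -1 - 1/z give (1,0) = (0,1) and (1,1) = (0,2);
   as -1 has class 0 but contributes to no (0, j), the classes 0 and 1 could not be
   equinumerous if (1,2) were zero. *)
Lemma cube_class_consecutive :
  exists z : 'F_p, [/\ z != 0, cube_class z = 1%N, z + 1 != 0 & cube_class (z + 1) = 2%N].
Proof.
apply: contrapT => none.
have g0 := prim_root_neq0.
pose C k := [set x : 'F_p | (x != 0) && (cube_class x == k)].
(* Multiplication by [g] injects class 0 into class 1; the map [f] below injects class 1 into class
   0 without -1. *)
have C01 : (#|C 0%N| <= #|C 1%N|)%N.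
  rewrite -(card_imset (C 0%N) (mulfI g0)); apply/subset_leq_card/fintype.subsetP => _ /imsetP[x + ->].
  rewrite !inE mulf_eq0 negb_or g0 => /andP[x0 /eqP x1]; rewrite x0 /=.
  by rewrite cube_classM // x1 addn0 -(expr1 g) cube_class_exp.
have N1 : cube_class (-1) = 0%N.
  by rewrite cube_classN ?oner_eq0 // -(expr0 g) cube_class_exp.
(* By assumption z + 1 has class 0 or 1 when z has class 1. The class of [f z + 1], namely 1 or 2,
   reveals which branch was taken, whence injectivity. *)
pose f (z : 'F_p) : 'F_p := if cube_class (z + 1) == 0%N then - (z + 1) else - (z + 1) / z.
have fP (z : 'F_p) : z \in C 1%N -> [/\ f z \in C 0%N, f z != -1 &
     cube_class (f z + 1) = if cube_class (z + 1) == 0%N then 1%N else 2%N].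
  rewrite !inE => /andP[z0 /eqP z1].
  have z10 : z + 1 != 0.
    by apply/eqP => /(canRL (addrK _)); rewrite add0r => zE; move: z1; rewrite zE N1.
  have zV : cube_class z^-1 = 2%N.
    have := cube_classM z0 (invr_neq0 z0); rewrite divff // z1 -(expr0 g) cube_class_exp.
    by have := cube_class_lt z^-1; case: (cube_class _) => [|[|[|]]].
  rewrite /f; case: (cube_class (z + 1) =P 0%N) => [e0|e0].
    rewrite oppr_eq0 z10 cube_classN // e0 eqxx; split=> //.
      by rewrite eqr_opp -subr_eq0 addrK.
    by rewrite opprD addrNK cube_classN.
  have e1 : cube_class (z + 1) = 1%N.
    have := cube_class_lt (z + 1); case E: (cube_class _) => [|[|[|]]] // _.
    by case: none; exists z.
  rewrite mulf_neq0 ?invr_neq0 ?oppr_eq0 //= cube_classM ?oppr_eq0 ?invr_neq0 //.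
  rewrite cube_classN // e1 zV; split=> //.
    by rewrite mulNr eqr_opp mulrDl divff // mul1r -subr_eq0 addrAC subrr add0r invr_neq0.
  rewrite mulNr mulrDl divff // mul1r opprD addrAC addNr add0r.
  by rewrite cube_classN ?invr_neq0.
have f_inj : {in C 1%N &, injective f}.
  move=> z z' zC zC' ff; have [_ _ fz] := fP z zC; have [_ _ fz'] := fP z' zC'.
  have z0 : z != 0 by move: zC; rewrite inE => /andP[].
  have z0' : z' != 0 by move: zC'; rewrite inE => /andP[].
  have : (cube_class (z + 1) == 0%N) = (cube_class (z' + 1) == 0%N).
    by move: fz; rewrite ff fz'; do 2!case: eqP.
  move: ff; rewrite /f => + E; rewrite -E; case: ifP => _.
    by move/oppr_inj/addIr.
  by rewrite !mulNr => /oppr_inj; rewrite !mulrDl !divff // => /addrI; rewrite !mul1r => /invr_inj.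
have : (#|f @: C 1%N| <= #|C 0%N :\ (-1 : 'F_p)%R|)%N.
  apply/subset_leq_card/fintype.subsetP => _ /imsetP[z zC ->].
  by have [f0 f1 _] := fP z zC; rewrite in_setD1 f1.
rewrite (card_in_imset f_inj) => C10; have := cardsD1 (-1 : 'F_p)%R (C 0%N).
by rewrite inE oppr_eq0 oner_eq0 N1 eqxx /= => C0; have := leq_trans C01 C10; rewrite {1}C0 add1n ltnn.
Qed.

(** The elements 1, z and -(z + 1) have classes 0, 1, 2 and sum to zero; each coefficient is carried
    to the one in its class by a cube. *)
Lemma ternary_cubic_zero (x : nat -> 'F_p) :
  (forall k, (k < 3)%N -> x k != 0 /\ cube_class (x k) = k) ->
  exists2 y : nat -> 'F_p, y 0%N != 0 &
    x 0%N * y 0%N ^+ 3 + x 1%N * y 1%N ^+ 3 + x 2 * y 2 ^+ 3 = 0.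
Proof.
move=> xP; have [z [z0 z1 z10 z12]] := cube_class_consecutive.
have [x0 c0] := xP 0%N isT; have [x1 c1] := xP 1%N isT; have [x2 c2] := xP 2%N isT.
have [||a a0 aE] := @cube_class_eq (x 0%N) 1 x0; rewrite ?oner_eq0 //.
  by rewrite c0 -(expr0 g) cube_class_exp.
have [||b b0 bE] := @cube_class_eq (x 1%N) z x1; rewrite ?c1 //.
have [||e e0 eE] := @cube_class_eq (x 2%N) (- (z + 1)) x2; rewrite ?oppr_eq0 ?cube_classN ?c2 //.
exists (nth 0 [:: a; b; e]) => //=; rewrite aE bE eE; ring.
Qed.

Definition nat_cube_class (u : nat) : nat := cube_class u%:R.

Lemma nat_cube_class_mod u : nat_cube_class (u %% p) = nat_cube_class u.
Proof. by rewrite /nat_cube_class Fp_nat_mod. Qed.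

Lemma nat_cube_class_card k : (k < 3)%N ->
  (count (fun u => ~~ (p %| u)%N && (nat_cube_class u == k)) (iota 0 p) * 3 = p.-1)%N.
Proof.
move=> k3; have -> : count (fun u => ~~ (p %| u)%N && (nat_cube_class u == k)) (iota 0 p) =
    count (fun x : 'F_p => cube_class x == k) [seq u%:R | u <- iota 0 p & ~~ (p %| u)%N].
  by rewrite count_map count_filter; apply: eq_count => u /=; rewrite andbC.
have /permP -> : perm_eq [seq u%:R : 'F_p | u <- iota 0 p & ~~ (p %| u)%N] [seq g ^+ i | i <- iota 0 p.-1].
  apply: uniq_perm.
  - rewrite map_inj_in_uniq ?filter_uniq ?iota_uniq // => a b.
    rewrite !mem_filter !mem_iota !add0n /= => /andP[_ ap] /andP[_ bp] /(congr1 val) /=.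
    by rewrite !val_Fp_nat // !modn_small.
  - rewrite map_inj_in_uniq ?iota_uniq // => a b; rewrite !mem_iota !add0n /= => ap bp /eqP.
    by rewrite (eq_prim_root_expr g_prim) !modn_small // => /eqP.
  move=> x; apply/mapP/mapP => [[u]|[i]].
    rewrite mem_filter mem_iota => /andP[pu _] ->; exists (dlog u%:R).
      by rewrite mem_iota add0n dlog_lt // natr_Fp_eq0.
    by rewrite dlogK // natr_Fp_eq0.
  rewrite mem_iota => _ ->; exists (nat_of_ord (g ^+ i)); last by rewrite natr_Zp.
  rewrite mem_filter -natr_Fp_eq0 // natr_Zp expf_neq0 ?prim_root_neq0 // mem_iota add0n /=.
  by have := ltn_ord (g ^+ i); rewrite {2}Fp_cast.
rewrite count_map (eq_count (a2 := fun i => i %% 3 == k)%N) => [|i]; last by rewrite /= cube_class_exp.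
have [m pm] : exists m, (p.-1 = 3 * m)%N by exists (p.-1 %/ 3)%N; rewrite mulnC divnK.
rewrite pm count_iota_periodic; last by move=> r; rewrite modn_mod.
by case: k k3 => [|[|[|]]] //= _; lia.
Qed.

Definition at_most_two (w : seq nat) : bool :=
  all (fun j => count_mem j w <= 2)%N [:: 0; 1; 2]%N.

Lemma bad_one_mod_threeP d (J u : 'I_d -> nat) :
  (forall i, J i < 3)%N -> (forall i, ~~ (p %| u i))%N ->
  reduction_soluble p J u <->
  ~~ bad_types at_most_two [seq (J i, nat_cube_class (u i)) | i <- enum 'I_d].
Proof.
move=> J3 pu; have p3 : p != 3%N by apply: contra_eqN p_mod => /eqP ->.
have U0 i : (u i)%:R != 0 :> 'F_p by rewrite natr_Fp_eq0.
split.
  move/(reduction_soluble_Fp p_pr p3 u J3) => [j j3 [y ysum [i Ji yi]]].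
  apply/negP => /andP[/uniq_map_enumP inj /allP cnt].
  have jin : j \in [:: 0; 1; 2]%N by case: j j3 {ysum Ji} => [|[|[|]]].
  have {cnt jin} := cnt j jin; rewrite count_map_enum (cardsD1 i) inE Ji eqxx ltnS.
  case: (set_0Vmem ([set i | J i == j] :\ i)) => [E0 _|[k kin]].
    move: ysum; rewrite (bigD1 i) /= ?Ji // big1 ?addr0 => [/eqP|k /andP[Jk ki]].
      by rewrite mulf_eq0 (negPf (U0 i)) expf_eq0 (negPf yi).
    by have := finset.in_set0 k; rewrite -E0 !inE ki Jk.
  rewrite (cardsD1 k) kin ltnS leqn0 cards_eq0 => /eqP E0.
  move: kin; rewrite !inE => /andP[ki /eqP Jk].
  move: ysum; rewrite (bigD1 i) ?Ji // (bigD1 k) /= ?Jk ?eqxx ?ki // big1 ?addr0; last first.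
    by move=> l /andP[/andP[Jl li] lk]; have := finset.in_set0 l; rewrite -E0 !inE lk li Jl.
  move/eqP; rewrite addr_eq0 => /eqP E.
  have A0 : (u i)%:R * y i ^+ 3 != 0 by rewrite mulf_neq0 ?expf_neq0.
  have yk : y k != 0.
    by apply: contra_neq A0 => yk; rewrite E yk expr0n mulr0 oppr0.
  have : i = k.
    (* Two terms that cancel have coefficients of the same class, as -1 is a cube. *)
    apply: inj; rewrite Ji Jk; congr pair.
    rewrite /nat_cube_class -(@cube_class_cube _ (y i)) // E cube_classN ?cube_class_cube //.
    by rewrite mulf_neq0 ?expf_neq0.
  by move/eqP; rewrite eq_sym (negPf ki).
have same i i' : i != i' -> J i = J i' -> nat_cube_class (u i) = nat_cube_class (u i') ->
    reduction_soluble p J u.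
  move=> ii' JJ cc; have [z _ zE] := cube_class_eq (U0 i) (U0 i') cc.
  exact: (soluble_of_pair p_pr p3 J3 ii' JJ zE).
rewrite negb_and => /orP[/uniq_map_enumPn[i [i' [ii' [JJ cc]]]]|]; first exact: same cc.
case/allPn => j _; rewrite count_map_enum -ltnNge => /card_gt2P[i0 [i1 [i2 [[]]]]].
rewrite !inE => /eqP J0 /eqP J1 /eqP J2 [n01 n12 n20].
apply: contrapT => nsol.
pose l := [:: i0; i1; i2].
have lJ : {in l, forall i, J i = j} by move=> i; rewrite !inE => /or3P[] /eqP->.
have ul : uniq l by rewrite /= !inE negb_or n01 n12 eq_sym n20.
have inj : {in l &, injective (fun i => nat_cube_class (u i))}.
  move=> i i' il il' cc; apply/eqP; apply: contrapT => /negP ii'.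
  by apply: nsol; apply: (same i i'); rewrite ?lJ.
(* Three pairwise distinct classes exhaust 0, 1, 2. *)
have kl k : (k < 3)%N -> exists2 i, i \in l & nat_cube_class (u i) = k.
  move=> k3; have /mapP[i il ->] : k \in [seq nat_cube_class (u i) | i <- l]; last by exists i.
  have := @uniq_min_size _ [seq nat_cube_class (u i) | i <- l] (iota 0 3).
  rewrite map_inj_in_uniq // ul => /(_ isT); case=> [x /mapP[i _ ->]||_ ->] //.
    by rewrite mem_iota cube_class_lt.
  by rewrite mem_iota.
have [f fP] : exists f : nat -> 'I_d, forall k, (k < 3)%N -> f k \in l /\ nat_cube_class (u (f k)) = k.
  have [a al a0] := kl 0%N isT; have [b bl b1] := kl 1%N isT; have [e el e2] := kl 2%N isT.
  by exists (nth a [:: a; b; e]) => -[|[|[|]]].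
have [|y y0 ysum] := @ternary_cubic_zero (fun k => (u (f k))%:R).
  by move=> k k3; split; [exact: U0|case: (fP k k3)].
apply: nsol; apply: (@soluble_of_seq p p_pr p3 d J u J3 j [:: f 0; f 1; f 2]%N
  (fun i => y (nat_cube_class (u i))) (f 0%N)).
- apply: (@map_uniq _ _ (fun i => nat_cube_class (u i))); rewrite /=.
  by rewrite (fP 0%N isT).2 (fP 1%N isT).2 (fP 2%N isT).2.
- by move=> i; rewrite !inE => /or3P[] /eqP->; apply: lJ;
  case: (fP 0%N isT); case: (fP 1%N isT); case: (fP 2%N isT).
- by rewrite !inE eqxx.
- by rewrite (fP 0%N isT).2.
- rewrite !big_cons big_nil addr0 addrA.
  by rewrite (fP 0%N isT).2 (fP 1%N isT).2 (fP 2%N isT).2.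
Qed.

End OneModThree.

(** * Solubility modulo 9 *)

Section PrimeThree.
Local Open Scope nat_scope.

(* Every unit modulo 9 is, up to sign, one of 1, 2, 4. *)
Definition class_mod9 (u : nat) : nat := nth 0 [:: 0; 0; 1; 0; 2; 2; 0; 1; 0] (u %% 9).
Definition class_rep (k : nat) : nat := nth 0 [:: 1; 2; 4] k.

(** Relative to level j, terms of residue j + 1 carry a factor 3 and are still visible modulo 9,
    while those of residue j + 2 carry 9 and vanish; hence the asymmetry. *)
Definition separated (w : seq nat) : bool :=
  all (fun j => (count_mem j w <= 1) || (count_mem (j.+1 %% 3) w == 0)) [:: 0; 1; 2].

Let mem9 x : x %% 9 \in iota 0 9. Proof. by rewrite mem_iota ltn_mod. Qed.
Let dvd9 x : (3 %| x %% 9) = (3 %| x). Proof. by rewrite /dvdn modn_dvdm. Qed.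

Lemma class_mod9_lt u : class_mod9 u < 3.
Proof.
have : u %% 9 < 9 by rewrite ltn_mod.
by rewrite /class_mod9; case: (u %% 9) => [|[|[|[|[|[|[|[|[|m]]]]]]]]].
Qed.

Lemma class_mod9_cube u y : ~~ (3 %| u) -> exists e, [/\ e \in [:: 0; 1; 8],
  e * class_rep (class_mod9 u) = u * y ^ 3 %[mod 9] & (e != 0) = ~~ (3 %| y)].
Proof.
move=> u3.
have: all (fun u => all (fun y => (3 %| u) || has (fun e =>
    (e * class_rep (class_mod9 u) == u * y ^ 3 %[mod 9]) && ((e != 0) == ~~ (3 %| y)))
    [:: 0; 1; 8]) (iota 0 9)) (iota 0 9) by vm_compute.
move/allP/(_ _ (mem9 u))/allP/(_ _ (mem9 y)); rewrite !dvd9 (negPf u3) orFb.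
case/hasP => e e8 /andP[/eqP E1 /eqP E2]; exists e; split=> //.
have <- : (u %% 9) * (y %% 9) ^ 3 = u * y ^ 3 %[mod 9] by rewrite modnMml -modnMmr modnXm modnMmr.
by rewrite -E1 /class_mod9 modn_mod.
Qed.

Lemma class_mod9_same u u' : ~~ (3 %| u) -> ~~ (3 %| u') -> class_mod9 u = class_mod9 u' ->
  exists2 y, y != 0 & 9 %| u * y ^ 3 + u'.
Proof.
move=> u3 u3'.
have: all (fun u => all (fun u' => (3 %| u) || (3 %| u') || (class_mod9 u != class_mod9 u') ||
    has (fun y => 9 %| u * y ^ 3 + u') [:: 1; 2]) (iota 0 9)) (iota 0 9) by vm_compute.
move/allP/(_ _ (mem9 u))/allP/(_ _ (mem9 u')); rewrite !dvd9 (negPf u3) (negPf u3') !orFb.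
rewrite {1 2}/class_mod9 !modn_mod -/(class_mod9 u) -/(class_mod9 u') => + E.
rewrite E eqxx orFb => /hasP[y y12 dy]; exists y; first by case: y y12 {dy}.
by move: dy; rewrite /dvdn modnDmr -modnDml modnMml modnDml.
Qed.

(** A sign y^3 = 1 or -1 makes u + u' y^3 divisible by 3, and 3 u'' y''^3 runs through all multiples
    of 3 modulo 9. *)
Lemma three_units_mod9 u u' u'' : ~~ (3 %| u) -> ~~ (3 %| u') -> ~~ (3 %| u'') ->
  exists y y'', (9 %| u * 1 ^ 3 + u' * y ^ 3 + 3 * u'' * y'' ^ 3).
Proof.
move=> u3 u3' u3''.
have: all (fun u => all (fun u' => all (fun u'' => (3 %| u) || (3 %| u') || (3 %| u'') ||
    has (fun y => has (fun y'' => 9 %| u + u' * y ^ 3 + 3 * u'' * y'' ^ 3) [:: 0; 1; 2])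
    [:: 1; 2]) (iota 0 9)) (iota 0 9)) (iota 0 9) by vm_compute.
move/allP/(_ _ (mem9 u))/allP/(_ _ (mem9 u'))/allP/(_ _ (mem9 u'')).
rewrite !dvd9 (negPf u3) (negPf u3') (negPf u3'') !orFb => /hasP[y _ /hasP[y'' _ d9]].
exists y, y''; rewrite muln1.
have -> : u + u' * y ^ 3 + 3 * u'' * y'' ^ 3 =
    (u %/ 9 + u' %/ 9 * y ^ 3 + 3 * (u'' %/ 9) * y'' ^ 3) * 9 +
    (u %% 9 + u' %% 9 * y ^ 3 + 3 * (u'' %% 9) * y'' ^ 3).
  rewrite {1}(divn_eq u 9) {1}(divn_eq u' 9) {1}(divn_eq u'' 9).
  by move: (y ^ 3) (y'' ^ 3) => *; ring.
by rewrite /dvdn modnMDl.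
Qed.

(** As 8 = -1 modulo 9, this concerns signed sums of 1, 2, 4: they lie between -7 and 7, and vanish
    only trivially because 4 > 1 + 2 and 2 > 1. *)
Lemma class_rep_independent (e : nat -> nat) : (forall k, k < 3 -> e k \in [:: 0; 1; 8]) ->
  9 %| \sum_(k < 3) e k * class_rep k -> forall k, k < 3 -> e k = 0.
Proof.
move=> eP; have: all (fun a => all (fun b => all (fun c =>
    (9 %| a * 1 + b * 2 + c * 4) ==> [&& a == 0, b == 0 & c == 0])
    [:: 0; 1; 8]) [:: 0; 1; 8]) [:: 0; 1; 8] by vm_compute.
move/allP/(_ _ (eP 0 isT))/allP/(_ _ (eP 1 isT))/allP/(_ _ (eP 2 isT))/implyP.
rewrite !big_ord_recr big_ord0 /= add0n => h /h /and3P[/eqP e0 /eqP e1 /eqP e2].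
by case=> [|[|[|]]].
Qed.

Lemma bad_threeP d (J u : 'I_d -> nat) :
  (forall i, J i < 3) -> (forall i, ~~ (3 %| u i)) ->
  reduction_soluble 3 J u <->
  ~~ bad_types separated [seq (J i, class_mod9 (u i)) | i <- enum 'I_d].
Proof.
move=> J3 u3.
have shift0 i j : J i = j -> shift_exp j (J i) = 0.
  by move=> <-; rewrite /shift_exp subnKC ?modnn // ltnW.
have sum_supp (l : seq 'I_d) (F : 'I_d -> nat -> nat) (y : 'I_d -> nat) : uniq l ->
    (forall i, F i 0 = 0) ->
    \sum_i F i (if i \in l then y i else 0) = \sum_(i <- l) F i (y i).
  move=> ul F0; rewrite [RHS]big_uniq // [RHS]big_mkcond; apply: eq_bigr => i _.
  by case: (i \in l); rewrite ?F0.
split.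
  move=> [j j3 [y ysum [i Ji yi]]]; apply/negP => /andP[/uniq_map_enumP inj /allP sep].
  have jin : j \in [:: 0; 1; 2] by case: j j3 {ysum Ji} => [|[|[|]]].
  have {sep jin} := sep j jin; rewrite !count_map_enum => /orP[c1|c0].
    (* If residue j occurs only at i, the congruence modulo 3 already forces 3 to divide [y i]. *)
    have others k : k != i -> 3 %| 3 ^ shift_exp j (J k) * u k * y k ^ 3.
      move=> ki; rewrite -mulnA dvdn_mulr //.
      have Jk : J k != j.
        apply: contraL c1 => Jk; rewrite -ltnNge; apply/card_gt1P; exists i, k.
        by rewrite !inE Ji Jk eqxx eq_sym ki.
      rewrite -{1}(expn1 3) dvdn_exp2l // /shift_exp; move: Jk (J3 k) j3.
      by case: (J k) => [|[|[|]]] //; case: (j) => [|[|[|]]].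
    have := dvdn_trans (isT : 3 %| 9) ysum; rewrite (bigD1 i) //= dvdn_addl; last first.
      exact: dvdn_sum.
    by rewrite shift0 // mul1n Euclid_dvdM // Euclid_dvdX // andbT (negPf (u3 i)) (negPf yi).
  have /boolp.choice[e eP] i' := class_mod9_cube (y i') (u3 i').
  (* Types are distinct, so each class occurs at most once at level j and [E k] is a single
     coefficient or 0. *)
  pose E k := \sum_(i' | (J i' == j) && (class_mod9 (u i') == k)) e i'.
  have Euniq i' : J i' = j -> E (class_mod9 (u i')) = e i'.
    move=> Ji'; rewrite /E (bigD1 i') /= ?Ji' ?eqxx // big1 ?addn0 // => k.
    case/andP => /andP[/eqP Jk /eqP ck]; case/eqP; apply: inj.
    by rewrite Jk Ji' ck.
  have E8 k : k < 3 -> E k \in [:: 0; 1; 8].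
    move=> _; case: (pickP (fun i' => (J i' == j) && (class_mod9 (u i') == k))).
      by move=> i' /andP[/eqP Ji' /eqP <-]; rewrite Euniq //; case: (eP i').
    by move=> none; rewrite /E big_pred0.
  have Esum : 9 %| \sum_(k < 3) E k * class_rep k.
    have -> : \sum_(k < 3) E k * class_rep k =
        \sum_i' (if J i' == j then e i' * class_rep (class_mod9 (u i')) else 0).
      rewrite -big_mkcond (partition_big (fun i' => Ordinal (class_mod9_lt (u i'))) predT) //=.
      apply: eq_bigr => k _; rewrite big_distrl /=; apply: eq_big => [i'|i'].
        by rewrite -val_eqE.
      by case/andP => _ /eqP ->.
    move: ysum; rewrite (@dvdn_sum_congr _ _ _
      (fun i' => if J i' == j then e i' * class_rep (class_mod9 (u i')) else 0)) // => i'.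
    have [_ ei _] := eP i'; case: eqP => [Ji'|/eqP Ji'].
      by rewrite shift0 // mul1n ei.
    have J1 : J i' != j.+1 %% 3.
      apply/eqP => J1; move: c0; rewrite cards_eq0 => /eqP c0.
      by have := finset.in_set0 i'; rewrite -c0 inE J1 eqxx.
    have -> : shift_exp j (J i') = 2.
      move: Ji' J1 (J3 i') j3; rewrite /shift_exp.
      by case: (J i') => [|[|[|]]] //; case: (j) => [|[|[|]]].
    by rewrite -mulnA modnMr.
  have := class_rep_independent E8 Esum (class_mod9_lt (u i)).
  by rewrite Euniq // => e0; have [_ _] := eP i; rewrite e0 (negPf yi).
rewrite negb_and => /orP[/uniq_map_enumPn[i [i' [ii' [JJ cc]]]]|].
  have [z z0 dz] := class_mod9_same (u3 i) (u3 i') cc.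
  have i'i : (i' == i) = false by rewrite eq_sym; apply: negbTE.
  exists (J i) => //; exists (fun k => if k \in [:: i; i'] then (if k == i then z else 1) else 0).
    rewrite (@sum_supp [:: i; i'] (fun k x => 3 ^ shift_exp (J i) (J k) * u k * x ^ 3)); last 2 first.
    - by rewrite /= inE ii'.
    - by move=> k; rewrite muln0.
    by rewrite big_cons big_seq1 eqxx i'i !shift0 // !mul1n muln1.
  by exists i' => //; rewrite !inE eqxx orbT i'i.
case/allPn => j j3; rewrite !count_map_enum negb_or -ltnNge -lt0n.
case/andP => /card_gt1P[i [i' [+ + ii']]] /card_gt0P[i''].
rewrite !inE => /eqP Ji /eqP Ji' /eqP Ji''.
have [y [y'' d9]] := three_units_mod9 (u3 i) (u3 i') (u3 i'').
have j3' : j < 3 by move: j3; rewrite !inE => /or3P[] /eqP->.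
have neq k : J k = j -> (i'' == k) = false.
  move=> Jk; apply/eqP => ik; move: Ji''; rewrite ik Jk.
  by case: (j) j3' => [|[|[|]]].
have i'i : (i' == i) = false by rewrite eq_sym; apply: negbTE.
exists j => //; exists (fun k => if k \in [:: i; i'; i''] then
    (if k == i then 1 else if k == i' then y else y'') else 0).
  rewrite (@sum_supp [:: i; i'; i''] (fun k x => 3 ^ shift_exp j (J k) * u k * x ^ 3)); last 2 first.
  - by rewrite /= !inE negb_or ii' eq_sym neq // eq_sym neq.
  - by move=> k; rewrite muln0.
  rewrite 2!big_cons big_seq1 eqxx i'i eqxx !neq // (shift0 i) // (shift0 i') // !mul1n.
  have -> : shift_exp j (J i'') = 1 by rewrite Ji''; case: (j) j3' => [|[|[|]]].
  by rewrite expn1 addnA.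
by exists i => //; rewrite !inE eqxx.
Qed.

End PrimeThree.

(** * Weights of the bad tuples *)

Section Multiplicity.
Variables (N : nat) (C : pred (seq nat)).
Hypothesis C_tail : forall j w, C (j :: w) -> C w.

(* Words of residues modulo 3, each with the number of bad words of types lying over it. *)
Fixpoint weighted_words d : seq (seq nat * nat) :=
  if d is d'.+1 then
    [seq x <- [seq (j :: y.1, if C (j :: y.1) then (y.2 * (N - count_mem j y.1))%N else 0%N)
              | j <- iota 0 3, y <- weighted_words d'] | x.2 != 0%N]
  else [:: ([::], nat_of_bool (C [::]))].

Lemma bad_types_tail z s : bad_types C (z :: s) -> bad_types C s.
Proof. by case/andP => /andP[_ us] /C_tail Cs; apply/andP. Qed.

Lemma count_free_classes j (s : seq (nat * nat)) : uniq s -> all (fun z => z.2 < N)%N s ->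
  count (fun k => (j, k) \notin s) (iota 0 N) = (N - count_mem j (map fst s))%N.
Proof.
move=> us /allP sN.
have -> : count_mem j (map fst s) = count (fun k => (j, k) \in s) (iota 0 N).
  rewrite count_map -!size_filter -[RHS](size_map (pair j)); apply: perm_size; apply: uniq_perm.
  - exact: filter_uniq.
  - by rewrite map_inj_uniq ?filter_uniq ?iota_uniq // => ? ? [].
  move=> [j' k]; rewrite mem_filter /=; apply/andP/mapP => [[/eqP -> zs]|[k' + [-> ->]]].
    by exists k => //; rewrite mem_filter zs mem_iota (sN _ zs).
  by rewrite mem_filter eqxx => /andP[].
have := count_predC (fun k => (j, k) \in s) (iota 0 N); rewrite size_iota => NE.
by rewrite -[X in _ = (X - _)%N]NE addKn.
Qed.

(** Bad words have bad tails, so they arise by prefixing (j, k) to bad words; types being distinct,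
    k avoids the classes already used with j, which leaves N minus the number of occurrences of j.
    Words dropped for multiplicity 0 have no bad extension. *)
Lemma sum_bad_types (R : comNzRingType) d (F : seq nat -> R) :
  \sum_(s <- words (types N) d | bad_types C s) F (map fst s) =
  \sum_(x <- weighted_words d) x.2%:R * F x.1.
Proof.
elim: d F => [|d IH] F.
  by rewrite big_mkcond !big_seq1 /bad_types /=; case: (C _); rewrite ?mul1r ?mul0r.
rewrite big_mkcond [words _ _]/(words _ d.+1) [weighted_words _]/(weighted_words d.+1).
rewrite [RHS]big_filter [RHS]big_mkcond.
under [RHS]eq_bigr => x _.
  rewrite (_ : (if _ then _ else _) = x.2%:R * F x.1); last first.
    by case: eqP => // ->; rewrite mul0r.
  over.
rewrite !big_allpairs_dep; apply: eq_bigr => j _ /=.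
transitivity (\sum_(s <- words (types N) d | bad_types C s)
   (C (j :: map fst s) * (N - count_mem j (map fst s)))%:R * F (j :: map fst s)).
  rewrite exchange_big [RHS]big_mkcond /= big_seq [RHS]big_seq; apply: eq_bigr => s sW.
  case: ifP => [/andP[us Cs]|nb]; last first.
    by rewrite big1 // => k _; case: ifP => // /bad_types_tail; rewrite nb.
  have sN : all (fun z => z.2 < N)%N s.
    apply/allP => z zs; move: sW; rewrite mem_words => /andP[_ /allP/(_ z zs)].
    by case/allpairsPdep => a [b [_ + ->]]; rewrite mem_iota.
  rewrite -count_free_classes // -big_mkcond big_const_seq iter_addr addr0.
  rewrite mulr_natl; congr (_ *+ _); rewrite /bad_types /= us.
  case: (C _); rewrite ?mul1n ?mul0n; first by apply: eq_count => k; rewrite !andbT.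
  by rewrite (eq_count (a2 := pred0)) ?count_pred0 // => k; rewrite !andbF.
rewrite (IH (fun w => (C (j :: w) * (N - count_mem j w))%:R * F (j :: w))).
apply: eq_bigr => y _; rewrite mulrA -natrM; congr (_%:R * _).
by case: (C _); rewrite ?mul1n ?muln0.
Qed.

End Multiplicity.

Definition degree_multiplicities N C d : seq (nat * nat) :=
  [seq (sumn x.1, x.2) | x <- weighted_words N C d].

(** [h] is a certificate for L sorted by degree: the coefficients of a polynomial in 1/q, verified
    by computation. *)
Definition grouped (h L : seq (nat * nat)) : bool :=
  [&& uniq (map fst h), all (fun x => x.1 \in map fst h) L &
      all (fun y => sumn [seq x.2 | x <- L & x.1 == y.1] == y.2) h].

Lemma grouped_sum (R : comNzRingType) (f : nat -> R) h L : grouped h L ->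
  \sum_(x <- L) x.2%:R * f x.1 = \sum_(x <- h) x.2%:R * f x.1.
Proof.
case/and3P => uh /allP Lh /allP hc; symmetry.
transitivity (\sum_(y <- h) \sum_(x <- L | x.1 == y.1) x.2%:R * f x.1).
  rewrite big_seq [RHS]big_seq; apply: eq_bigr => y yh.
  rewrite (eq_bigr (fun x => x.2%:R * f y.1)) => [|x /eqP-> //].
  by rewrite -mulr_suml -natr_sum -(eqP (hc y yh)) sumnE big_map big_filter.
rewrite (exchange_big_dep predT) //= big_seq [RHS]big_seq; apply: eq_bigr => x xL.
rewrite -(big_map fst (fun k => x.1 == k) (fun=> x.2%:R * f x.1)).
rewrite -big_filter (_ : [seq k <- map fst h | x.1 == k] = [:: x.1]) ?big_seq1 //.
by rewrite -(filter_pred1_uniq uh (Lh x xL)); apply: eq_filter => k; rewrite eq_sym.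
Qed.

Section BadWeight.
Variables (R : realType) (p N n : nat) (C : pred (seq nat)).
Hypothesis C_tail : forall j w, C (j :: w) -> C w.
Let q : R := p%:R.

Lemma bad_weight_grouped h : grouped h (degree_multiplicities N C n.+1) ->
  bad_weight R p N n (bad_types C) =
  ((1 - q^-1) / (1 - q ^- 3) / N%:R) ^+ n.+1 * \sum_(x <- h) x.2%:R * q ^- x.1.
Proof.
move=> /(grouped_sum (fun k => q ^- k)) <-; set X := _ / N%:R.
have wE z : type_weight R p N z = q ^- z.1 * X by rewrite /X mulrA.
rewrite big_map /= -(sum_bad_types N C_tail n.+1 (fun w => q ^- sumn w)).
rewrite /bad_weight big_distrr big_seq_cond [RHS]big_seq_cond.
apply: eq_bigr => s /andP[+ _]; rewrite mem_words => /andP[/eqP <- _].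
elim: s => [|z s IH]; first by rewrite big_nil /= expr0 mul1r invr1.
by rewrite big_cons IH wE /= exprD invfM exprS [q ^- z.1 * X]mulrC mulrACA.
Qed.

(** One evaluation at length m settles all larger n, since a longer bad word would have a bad tail
    of length m. *)
Lemma bad_weight_eq0 m : (m <= n.+1)%N -> nilp (weighted_words N C m) ->
  bad_weight R p N n (bad_types C) = 0.
Proof.
move=> mn /nilP L0; rewrite /bad_weight -big_filter.
suff : ~~ has (bad_types C) (words (types N) n.+1).
  by rewrite has_filter negbK => /eqP ->; rewrite big_nil.
apply: (words_tail_closed (@bad_types_tail C C_tail) mn); rewrite has_count -leqNgt leqn0.
rewrite -(pnatr_eq0 R) -sum1_count natr_sum (sum_bad_types N C_tail m (fun=> 1)).
by rewrite L0 big_nil.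
Qed.

End BadWeight.

Lemma at_most_two_tail j w : at_most_two (j :: w) -> at_most_two w.
Proof.
by move/allP => h; apply/allP => k /h; apply: leq_trans; rewrite /= leq_addl.
Qed.

Lemma separated_tail j w : separated (j :: w) -> separated w.
Proof.
move/allP => h; apply/allP => k /h /orP[c1|c0]; apply/orP; [left|right].
  by apply: leq_trans c1; rewrite /= leq_addl.
by move: c0; rewrite /= addn_eq0 => /andP[].
Qed.

(** * Evaluation of the densities for each class of p modulo 3 *)

Section LocalDensities.
Variables (R : realType) (p : nat).
Hypothesis p_pr : prime p.
Let q : R := p%:R.
Let t : R := (1 - q^-1) / (1 - q ^- 3).

Let q_gt1 : 1 < q. Proof. by rewrite ltr1n prime_gt1. Qed.
Let q_neq0 : q != 0. Proof. by rewrite gt_eqF // (lt_trans ltr01). Qed.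
Let q3_neq1 : q ^+ 3 - 1 != 0. Proof. by rewrite subr_eq0 gt_eqF // exprn_egt1. Qed.

Lemma rho_two_mod_three n : (p %% 3 = 2)%N ->
  rho R p n 3 = (1 - bad_weight R p 1 n (bad_types predT))%:E.
Proof.
move=> p2; have p3 : p != 3%N by apply: contra_eqN p2 => /eqP ->.
have c1 : cube_prec p = 1%N by rewrite /cube_prec (negPf p3).
apply: (@rho_bad_weight R p p_pr 1 (fun=> 0%N)) => //; last first.
  by move=> J u J3 pu; apply: bad_two_mod_three.
case=> // _; rewrite c1 muln1 expn1 mul1n.
have -> : iota 0 p = 0%N :: iota 1 p.-1 by rewrite -{1}(prednK (prime_gt0 p_pr)).
rewrite /= dvdn0 add0n -[RHS](size_iota 1); apply/eqP; rewrite -all_count.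
apply/allP => u; rewrite mem_iota => /andP[u0 up]; rewrite andbT.
by apply/negP => /dvdn_leq; rewrite u0 => /(_ isT); lia.
Qed.

Lemma rho_one_mod_three n : (p %% 3 = 1)%N ->
  rho R p n 3 = (1 - bad_weight R p 3 n (bad_types at_most_two))%:E.
Proof.
move=> p1; have p3 : p != 3%N by apply: contra_eqN p1 => /eqP ->.
have c1 : cube_prec p = 1%N by rewrite /cube_prec (negPf p3).
have [g g_prim] := Fp_prim_root p_pr.
apply: (@rho_bad_weight R p p_pr 3 (nat_cube_class g)) => //.
- by move=> u; rewrite c1 expn1 nat_cube_class_mod.
- by move=> u _; apply: cube_class_lt.
- by move=> k k3; rewrite c1 expn1 mul1n nat_cube_class_card.
- by move=> J u J3 pu; apply: bad_one_mod_threeP.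
Qed.

Lemma rho_three n : p = 3%N ->
  rho R p n 3 = (1 - bad_weight R p 3 n (bad_types separated))%:E.
Proof.
move=> p3; apply: (@rho_bad_weight R p p_pr 3 class_mod9); rewrite ?p3 //.
- by move=> u; rewrite /class_mod9 modn_mod.
- by move=> u _; apply: class_mod9_lt.
- by case=> [|[|[|]]].
- exact: bad_threeP.
Qed.

Lemma rho2_one_mod_three : (p %% 3 = 1)%N -> rho R p 2 3 = (1 - 2 * q^-1 * t)%:E.
Proof.
move=> p1; rewrite rho_one_mod_three //; congr (1 - _)%:E.
(* With x = 1/q the sum is 54 x (1 + x + x^2)^2. As (1 + x + x^2) t = 1, two of the three factors t
   cancel. *)
rewrite (bad_weight_grouped _ _ at_most_two_tail
  (h := [:: (1, 54); (2, 108); (3, 162); (4, 108); (5, 54)]%N)); last by vm_compute.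
by rewrite !big_cons big_nil -/q /t; cbn [fst snd]; field; rewrite q_neq0 q3_neq1.
Qed.

Lemma rho3_one_mod_three : (p %% 3 = 1)%N ->
  rho R p 3 3 = (1 - 8%:R / 3%:R * q ^- 2 * (1 + q^-1) ^+ 2 * t ^+ 3)%:E.
Proof.
move=> p1; rewrite rho_one_mod_three //; congr (1 - _)%:E.
(* The sum is 216 x^2 (1 + x)^2 (1 + x + x^2) with x = 1/q; its last factor cancels one t. *)
rewrite (bad_weight_grouped _ _ at_most_two_tail
  (h := [:: (2, 216); (3, 648); (4, 864); (5, 648); (6, 216)]%N)); last by vm_compute.
by rewrite !big_cons big_nil -/q /t; cbn [fst snd]; field; rewrite q_neq0 q3_neq1.
Qed.

Lemma rho4_one_mod_three : (p %% 3 = 1)%N ->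
  rho R p 4 3 = (1 - 40%:R / 3%:R * q ^- 4 * t ^+ 4)%:E.
Proof.
move=> p1; rewrite rho_one_mod_three //; congr (1 - _)%:E.
rewrite (bad_weight_grouped _ _ at_most_two_tail
  (h := [:: (4, 3240); (5, 3240); (6, 3240)]%N)); last by vm_compute.
by rewrite !big_cons big_nil -/q /t; cbn [fst snd]; field; rewrite q_neq0 q3_neq1.
Qed.

Lemma rho5_one_mod_three : (p %% 3 = 1)%N ->
  rho R p 5 3 = (1 - 80%:R / 3%:R * q ^- 6 * t ^+ 6)%:E.
Proof.
move=> p1; rewrite rho_one_mod_three //; congr (1 - _)%:E.
(* Each residue occurs exactly twice: 3^3 choices of two classes per residue and 6! orders of the
   six types. *)
rewrite (bad_weight_grouped _ _ at_most_two_tail (h := [:: (6, 720 * 27)]%N)); last by vm_compute.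
by rewrite !big_cons big_nil -/q /t; cbn [fst snd]; field; rewrite q_neq0 q3_neq1.
Qed.

Lemma rho_one_mod_three_eq1 n : (p %% 3 = 1)%N -> (6 <= n)%N -> rho R p n 3 = 1%:E.
Proof.
move=> p1 n6; rewrite rho_one_mod_three //.
have w0 : nilp (weighted_words 3 at_most_two 7) by vm_compute.
by rewrite (bad_weight_eq0 _ _ at_most_two_tail (n6 : 7 <= n.+1)%N w0) subr0.
Qed.

Lemma rho2_two_mod_three : (p %% 3 = 2)%N -> rho R p 2 3 = (1 - 6 * q ^- 3 * t ^+ 3)%:E.
Proof.
move=> p2; rewrite rho_two_mod_three //; congr (1 - _)%:E.
rewrite (bad_weight_grouped _ _ (C := predT) (fun _ _ => id) (h := [:: (3, 6)]%N)); last by vm_compute.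
by rewrite !big_cons big_nil -/q -/t; cbn [fst snd]; rewrite divr1 addr0 mulrC.
Qed.

Lemma rho_two_mod_three_eq1 n : (p %% 3 = 2)%N -> (3 <= n)%N -> rho R p n 3 = 1%:E.
Proof.
move=> p2 n3; rewrite rho_two_mod_three //.
have w0 : nilp (weighted_words 1 predT 4) by vm_compute.
by rewrite (bad_weight_eq0 _ _ (C := predT) (fun _ _ => id) (n3 : 4 <= n.+1)%N w0) subr0.
Qed.

Lemma rho2_three : p = 3%N -> rho R p 2 3 = (13831%:R / 19773%:R)%:E.
Proof.
move=> p3; rewrite rho_three //; congr EFin.
(* For instance 168 is 162 words with residues 0, 1, 2 plus 6 with residues 1, 1, 1; degrees 1 and 4
   are absent because 0, 0, 1 and 1, 1, 2 and 2, 2, 0 are not separated. *)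
rewrite (bad_weight_grouped _ _ separated_tail
  (h := [:: (0, 6); (2, 108); (3, 168); (5, 54); (6, 6)]%N)); last by vm_compute.
by rewrite !big_cons big_nil p3; cbn [fst snd]; field.
Qed.

Lemma rho3_three : p = 3%N -> rho R p 3 3 = (6391%:R / 6591%:R)%:E.
Proof.
move=> p3; rewrite rho_three //; congr EFin.
(* The residues are 0, 0, 0, 2 or 1, 1, 1, 0 or 2, 2, 2, 1, each with 4 orders, 3! choices for the
   triple and 3 for the single class. *)
rewrite (bad_weight_grouped _ _ separated_tail
  (h := [:: (2, 72); (3, 72); (7, 72)]%N)); last by vm_compute.
by rewrite !big_cons big_nil p3; cbn [fst snd]; field.
Qed.

Lemma rho_three_eq1 n : p = 3%N -> (4 <= n)%N -> rho R p n 3 = 1%:E.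
Proof.
move=> p3 n4; rewrite rho_three //.
have w0 : nilp (weighted_words 3 separated 5) by vm_compute.
by rewrite (bad_weight_eq0 _ _ separated_tail (n4 : 5 <= n.+1)%N w0) subr0.
Qed.

Lemma rho_eq1 n : (p %% 3 <> 1)%N -> (4 <= n)%N -> rho R p n 3 = 1%:E.
Proof.
move=> p1 n4; have [p0|p2] : (3 %| p)%N \/ (p %% 3 = 2)%N by rewrite /dvdn; lia.
  by apply: rho_three_eq1 => //; apply/esym/eqP; rewrite -dvdn_prime2.
by apply: rho_two_mod_three_eq1 => //; apply: ltnW.
Qed.

End LocalDensities.

Theorem theorem1p4 (R : realType) (p : nat) (hp : prime p) :
  let q : R := p%:R in
  let t : R := (1 - q^-1) / (1 - q ^- 3) in
  [/\ (* (1) *)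
      [/\ p = 3%N -> rho R p 2 3 = (13831%:R / 19773%:R : R)%:E,
          (p %% 3 = 1)%N -> rho R p 2 3 = (1 - 2 * q^-1 * t)%:E &
          (p %% 3 = 2)%N -> rho R p 2 3 = (1 - 6 * q ^- 3 * t ^+ 3)%:E],
      (* (2) *)
      [/\ p = 3%N -> rho R p 3 3 = (6391%:R / 6591%:R : R)%:E,
          (p %% 3 = 1)%N ->
            rho R p 3 3 = (1 - 8%:R / 3%:R * q ^- 2 * (1 + q^-1) ^+ 2 * t ^+ 3)%:E &
          (p %% 3 = 2)%N -> rho R p 3 3 = 1%:E],
      (* (3) *)
      ((p %% 3 = 1)%N -> rho R p 4 3 = (1 - 40%:R / 3%:R * q ^- 4 * t ^+ 4)%:E) /\
      ((p %% 3 <> 1)%N -> rho R p 4 3 = 1%:E),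
      (* (4) *)
      ((p %% 3 = 1)%N -> rho R p 5 3 = (1 - 80%:R / 3%:R * q ^- 6 * t ^+ 6)%:E) /\
      ((p %% 3 <> 1)%N -> rho R p 5 3 = 1%:E) &
      (* (5) *)
      forall n : nat, (6 <= n)%N -> rho R p n 3 = 1%:E].
Proof.
move=> q t; split; last first.
- move=> n n6; have [p1|p1] := eqVneq (p %% 3)%N 1%N; first exact: rho_one_mod_three_eq1.
  by apply: rho_eq1 => //; [exact/eqP|apply: leq_trans n6].
- by split=> [|p1]; [exact: rho5_one_mod_three|exact: rho_eq1].
- by split=> [|p1]; [exact: rho4_one_mod_three|exact: rho_eq1].
- split; [exact: rho3_three|exact: rho3_one_mod_three|].
  by move=> p2; apply: rho_two_mod_three_eq1.
- by split; [exact: rho2_three|exact: rho2_one_mod_three|exact: rho2_two_mod_three].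
Qed.
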